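(* The \textsc{Quoridor} decision problem (given a position of two-player Quoridor on an $n\times n$ board, decide whether White has a winning strategy) is in PSPACE.
   Context: Generalized two-player Quoridor is played on an $n\times n$ square grid by White, who aims to reach the top rank, and Black, who aims to reach the bottom rank. Each player has one pawn and a supply of wall pieces; the total number of wall pieces is at most $n^2$. A position specifies $n$, the locations of both pawns, the walls already on the board, the number of walls left in each player's supply, and the player to move. On a turn a player either moves their pawn or places a wall from their supply. Pawn moves: a pawn moves one square orthogonally, not through a wall. If the opposing pawn is orthogonally adjacent, the pawn may jump over it to the square directly behind it. If that square is blocked by a wall or by the board edge, the pawn may instead land on a square orthogonally beside the opposing pawn, unless that move is itself blocked by a wall. Walls: a wall has length 2 and width 0 and is placed along the boundary between squares. Walls may not overlap and may not cross to form a plus. A wall may not be placed if it would leave either player with no path to their goal rank. Walls are never removed. Winning: the first player whose pawn reaches the opposite edge of the board wins. There is no repetition rule, so a game may continue forever without a winner. The \textsc{Quoridor} decision problem asks whether, in a given position, White has a strategy that forces a win. *)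

(* Defs.v *)
From mathcomp Require Import all_boot.

Set Implicit Arguments.
Unset Strict Implicit.
Unset Printing Implicit Defensive.

(** * Polynomial space *)

(** A tape is two-way infinite.  Only the cells that carry input or have been
    visited are represented: [left_of], listed from the head outwards, then the
    scanned cell [head], then [right_of], again from the head outwards.  All
    other cells are blank, and represented cells are never dropped, so
    [tape_space] counts the input cells together with the visited cells. *)
Record tape (A : Type) := Tape { left_of : seq A; scanned : A; right_of : seq A }.

Definition tape_space (A : Type) (T : tape A) : nat :=
  (size (left_of T) + size (right_of T)).+1.

Inductive direction := GoLeft | GoRight | Stay.

Definition tape_write (A : Type) (a : A) (T : tape A) : tape A :=
  Tape (left_of T) a (right_of T).

Definition tape_move (A : Type) (blank : A) (d : direction) (T : tape A) : tape A :=
  match d with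
  | GoLeft => Tape (behead (left_of T)) (head blank (left_of T))
                   (scanned T :: right_of T)
  | GoRight => Tape (scanned T :: left_of T) (head blank (right_of T))
                    (behead (right_of T))
  | Stay => T
  end.

(** Tape symbols over a work alphabet [G]: [None] is the blank,
    [Some (inl b)] is the input bit [b], [Some (inr g)] is a work symbol. *)
Notation symbol G := (option (bool + G)%type).

(** Deterministic Turing machines with [extra_tapes.+1] read-write tapes, the
    input being written on tape [ord0].  [verdict q = None] means that [q] is
    not a halting state; [Some true] is acceptance, [Some false] rejection. *)
Record machine := Machine {
  extra_tapes : nat;
  state : finType;
  work : finType;
  start : state;
  verdict : state -> option bool;
  delta : state -> {ffun 'I_extra_tapes.+1 -> symbol work} ->
          state * ('I_extra_tapes.+1 -> symbol work * direction) }.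

Record config (M : machine) := Config {
  control : state M;
  tapes : {ffun 'I_(extra_tapes M).+1 -> tape (symbol (work M))} }.

Definition input_tape (G : finType) (w : seq bool) : tape (symbol G) :=
  let s := [seq Some (inl b) : symbol G | b <- w] in
  Tape [::] (head None s) (behead s).

Definition initial (M : machine) (w : seq bool) : config M :=
  Config (start M)
    [ffun i => if i == ord0 then input_tape (work M) w else input_tape (work M) [::]].

Definition step (M : machine) (c : config M) : config M :=
  if verdict (control c) is Some _ then c else
  let: (q, act) := delta (control c) [ffun i => scanned (tapes c i)] in
  Config q [ffun i => tape_move None (act i).2 (tape_write (act i).1 (tapes c i))].

Definition run (M : machine) (w : seq bool) (t : nat) : config M :=
  iter t (@step M) (initial M w).

Definition config_space (M : machine) (c : config M) : nat :=
  \sum_(i < (extra_tapes M).+1) tape_space (tapes c i).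

Definition language := seq bool -> Prop.

Definition decides (M : machine) (L : language) : Prop :=
  forall w, exists t b, verdict (control (run M w t)) = Some b /\ (b = true <-> L w).

Definition SPACE (f : nat -> nat) (L : language) : Prop :=
  exists M : machine, decides M L /\
  exists c, forall w t, config_space (run M w t) <= c * f (size w) + c.

Definition PSPACE (L : language) : Prop :=
  exists k, SPACE (fun m => m ^ k) L.

(** * Quoridor *)

(** A square is a pair (file, rank); rank [0] is the bottom rank and rank
    [n.-1] the top rank. *)
Notation square n := ('I_n * 'I_n)%type.

(** The wall [(o, (i, j))] is horizontal if [o] is [true] and vertical
    otherwise; its midpoint is the common corner of the four squares whose file
    is [i] or [i.+1] and whose rank is [j] or [j.+1]. *)
Notation wall n := (bool * ('I_n.-1 * 'I_n.-1))%type.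

Definition consecutive (a b : nat) : bool := (a == b.+1) || (b == a.+1).

Definition adjacent (n : nat) (s t : square n) : bool :=
  ((s.1 == t.1) && consecutive s.2 t.2) || ((s.2 == t.2) && consecutive s.1 t.1).

Definition around (n : nat) (w : wall n) (s : square n) : bool :=
  ((s.1 == w.2.1 :> nat) || (s.1 == w.2.1.+1 :> nat)) &&
  ((s.2 == w.2.2 :> nat) || (s.2 == w.2.2.+1 :> nat)).

(** Meant for adjacent [s] and [t]. *)
Definition separates (n : nat) (w : wall n) (s t : square n) : bool :=
  [&& around w s, around w t & if w.1 then s.2 != t.2 else s.1 != t.1].

Definition open (n : nat) (W : {set wall n}) (s t : square n) : bool :=
  adjacent s t && [forall w in W, ~~ separates w s t].

(** Walls with the same midpoint coincide or cross; parallel walls on the same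
    line overlap by half when their midpoints are at distance 1. *)
Definition conflict (n : nat) (w v : wall n) : bool :=
  (w.2 == v.2) ||
  ((w.1 == v.1) &&
   (if w.1 then (w.2.2 == v.2.2) && consecutive w.2.1 v.2.1
    else (w.2.1 == v.2.1) && consecutive w.2.2 v.2.2)).

Inductive player := White | Black.

Definition opponent (c : player) : player := if c is White then Black else White.

Definition goal (n : nat) (c : player) (s : square n) : bool :=
  if c is White then s.2 == n.-1 :> nat else s.2 == 0 :> nat.

(** Pawns do not obstruct the paths considered by the wall rule. *)
Definition has_path (n : nat) (W : {set wall n}) (c : player) (s : square n) : bool :=
  [exists g, goal c g && connect (open W) s g].

Record position (n : nat) := Position {
  white_pawn : square n;
  black_pawn : square n;
  walls : {set wall n};
  white_supply : nat;
  black_supply : nat;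
  turn : player }.

Definition pawn (n : nat) (P : position n) (c : player) : square n :=
  if c is White then white_pawn P else black_pawn P.

Definition supply (n : nat) (P : position n) (c : player) : nat :=
  if c is White then white_supply P else black_supply P.

(** [behind s o t]: [t] is the reflection of [s] in [o]. *)
Definition behind (n : nat) (s o t : square n) : bool :=
  (s.1 + t.1 == o.1.*2) && (s.2 + t.2 == o.2.*2).

(** [beside s o t]: [t] is adjacent to [o], in a direction perpendicular to the
    one leading from [s] to [o]. *)
Definition beside (n : nat) (s o t : square n) : bool :=
  [&& adjacent o t, s.1 != t.1 & s.2 != t.2].

(** A pawn on [s] can move to [t] when the opposing pawn is on [o]. *)
Definition pawn_can_move (n : nat) (W : {set wall n}) (s o t : square n) : bool :=
  [|| open W s t && (t != o),
      [&& open W s o, behind s o t & open W o t] |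
      [&& open W s o, ~~ [exists u, behind s o u && open W o u],
          beside s o t & open W o t]].

Definition wall_can_be_placed (n : nat) (P : position n) (w : wall n) : bool :=
  [&& 0 < supply P (turn P),
      [forall v in walls P, ~~ conflict w v],
      has_path (w |: walls P) White (white_pawn P) &
      has_path (w |: walls P) Black (black_pawn P)].

Definition move_pawn (n : nat) (P : position n) (t : square n) : position n :=
  if turn P is White
  then Position t (black_pawn P) (walls P) (white_supply P) (black_supply P) Black
  else Position (white_pawn P) t (walls P) (white_supply P) (black_supply P) White.

Definition place_wall (n : nat) (P : position n) (w : wall n) : position n :=
  if turn P is White
  then Position (white_pawn P) (black_pawn P) (w |: walls P)
         (white_supply P).-1 (black_supply P) Black
  else Position (white_pawn P) (black_pawn P) (w |: walls P)
         (white_supply P) (black_supply P).-1 White.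

Inductive legal_move (n : nat) (P : position n) : position n -> Prop :=
| PawnMove (t : square n) :
    pawn_can_move (walls P) (pawn P (turn P)) (pawn P (opponent (turn P))) t ->
    legal_move P (move_pawn P t)
| WallMove (w : wall n) :
    wall_can_be_placed P w -> legal_move P (place_wall P w).

Definition at_goal (n : nat) (P : position n) (c : player) : bool :=
  goal c (pawn P c).

(** The game goes on from [P]: nobody has won, and the player to move can move.
    (On the 2 x 2 board with one wall, pawns that face each other have no legal
    move; such a game stops without a winner.) *)
Definition live (n : nat) (P : position n) : Prop :=
  ~~ at_goal P White /\ ~~ at_goal P Black /\ exists Q, legal_move P Q.

(** A finished game is represented by repeating its last position forever. *)
Definition is_play (n : nat) (p : nat -> position n) : Prop :=
  forall t, (live (p t) -> legal_move (p t) (p t.+1)) /\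
            (~ live (p t) -> p t.+1 = p t).

(** A strategy maps the history of the game, current position last, to the
    next position. *)
Definition strategy (n : nat) := seq (position n) -> position n.

Definition white_strategy (n : nat) (sigma : strategy n) : Prop :=
  forall h (P : position n), turn P = White -> live P -> legal_move P (sigma (rcons h P)).

Definition white_follows (n : nat) (sigma : strategy n) (p : nat -> position n) : Prop :=
  forall t, turn (p t) = White -> live (p t) -> p t.+1 = sigma (mkseq p t.+1).

Definition white_can_force_win (n : nat) (P : position n) : Prop :=
  exists sigma : strategy n, white_strategy sigma /\
  forall p : nat -> position n,
    p 0 = P -> is_play p -> white_follows sigma p -> exists t, at_goal (p t) White.

(** Both pawns being on their goal ranks is excluded: play stops as soon as one
    of them gets there. *)
Definition valid_position (n : nat) (P : position n) : Prop :=
  [/\ white_pawn P != black_pawn P,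
      ~~ (at_goal P White && at_goal P Black),
      {in walls P &, forall w v, w != v -> ~~ conflict w v},
      has_path (walls P) White (white_pawn P) /\
      has_path (walls P) Black (black_pawn P) &
      #|walls P| + white_supply P + black_supply P <= n ^ 2].

Definition unary (m : nat) : seq bool := rcons (nseq m true) false.

Definition encode_square (n : nat) (s : square n) : seq bool := unary s.1 ++ unary s.2.

Definition wall_bitmap (n : nat) (W : {set wall n}) (o : bool) : seq bool :=
  [seq (o, (i, j)) \in W | i <- enum 'I_n.-1, j <- enum 'I_n.-1].

Definition encode (n : nat) (P : position n) : seq bool :=
  unary n ++ encode_square (white_pawn P) ++ encode_square (black_pawn P) ++
  unary (white_supply P) ++ unary (black_supply P) ++
  [:: if turn P is White then true else false] ++
  wall_bitmap (walls P) true ++ wall_bitmap (walls P) false.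

Definition QUORIDOR : language := fun w =>
  exists (n : nat) (P : position n),
    [/\ valid_position P, w = encode P & white_can_force_win P].

(* Main.v *)
Require Import Defs.
From mathcomp Require Import all_boot.
From mathcomp Require Import zify.

Set Implicit Arguments.
Unset Strict Implicit.
Unset Printing Implicit Defensive.

(** Between two wall placements only the pawns and the player to move can
    change, so a position that White can win is won within [2 n^4 (u + 1)]
    moves, where [u] is the number of walls in supply.  A depth-first search of
    the game tree to this depth keeps one frame per level, hence runs in
    polynomial space.

    No machine for the search is written down.  Instead, call a function on
    finite binary trees polynomial-space if a program with four stacks (one per
    tape) computes it in place on top of one stack, where trees are written in
    prefix notation.  Such functions contain the tree operations and are closed
    under composition, pairing, case analysis and loops whose intermediate
    values have polynomial size; the search, like each operation on positions,
    is built from these. *)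

(** * Stack programs *)

(** Without a repetition rule nothing evident bounds the length of a forced win. For fixed walls and
    supplies, the sets of pawn configurations won within [k] moves increase with [k], and there are
    only [2 n^4] such configurations; this is the origin of the depth. As [encode] writes the board
    size and the supplies in unary, the depth is polynomial in the length of the input, although the
    number of positions is exponential.

    A program is charged for stack height, and whatever lies below its argument counts only by its
    size; so a subroutine leaves a suspended computation intact and pays for its own argument alone.

    Polynomial bounds on a single move do not compose along a branch of polynomial length. The
    search therefore needs a potential that dominates the size of a position and never increases
    along a move: each wall still in supply is charged in advance for its future entry in the list
    of walls. *)

Notation reg := 'I_4.
(** Index 0 is the tape that carries the input of the machine. Once the input is loaded, only [main]
    is nonempty between two tree operations; the other stacks are scratch space. *)
Definition inp : reg := @Ordinal 4 0 isT.
Definition main : reg := @Ordinal 4 1 isT.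
Definition aux : reg := @Ordinal 4 2 isT.
Definition ctr : reg := @Ordinal 4 3 isT.

Record stacks := Stacks { s0 : seq bool; s1 : seq bool; s2 : seq bool; s3 : seq bool }.

Definition get (s : stacks) (i : reg) : seq bool :=
  match val i with 0 => s0 s | 1 => s1 s | 2 => s2 s | _ => s3 s end.

Definition upd (i : reg) (l : seq bool) (s : stacks) : stacks :=
  let: Stacks a b c d := s in
  match val i with
  | 0 => Stacks l b c d | 1 => Stacks a l c d
  | 2 => Stacks a b l d | _ => Stacks a b c l
  end.

Lemma get_upd i j l s : get (upd i l s) j = if j == i then l else get s j.
Proof.
case: s => a b c d.
by case: i => [[|[|[|[|i]]]] // Hi]; case: j => [[|[|[|[|j]]]] // Hj].
Qed.

Inductive cmd :=
| Skip
| Push (r : reg) (b : bool)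
| Pop (r : reg)
| Seq (c1 c2 : cmd)
| IfTop (r : reg) (p : pred (option bool)) (c1 c2 : cmd)
| WhileTop (r : reg) (p : pred (option bool)) (c : cmd).

(** Only pushes are checked against the height [h], as nothing else makes a stack grow. A derivation
    is finite, so it yields termination and the space bound together. *)
Inductive exec (h : nat) : cmd -> stacks -> stacks -> Prop :=
| ESkip s : exec h Skip s s
| EPush r b s : size (get s r) < h -> exec h (Push r b) s (upd r (b :: get s r) s)
| EPop r b l s : get s r = b :: l -> exec h (Pop r) s (upd r l s)
| ESeq c1 c2 s t u : exec h c1 s t -> exec h c2 t u -> exec h (Seq c1 c2) s u
| EIfT r (p : pred (option bool)) c1 c2 s t : p (ohead (get s r)) -> exec h c1 s t ->
    exec h (IfTop r p c1 c2) s t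
| EIfF r (p : pred (option bool)) c1 c2 s t : ~~ p (ohead (get s r)) -> exec h c2 s t ->
    exec h (IfTop r p c1 c2) s t
| EWhileT r (p : pred (option bool)) c s t u : p (ohead (get s r)) -> exec h c s t ->
    exec h (WhileTop r p c) t u -> exec h (WhileTop r p c) s u
| EWhileF r (p : pred (option bool)) c s : ~~ p (ohead (get s r)) ->
    exec h (WhileTop r p c) s s.

Lemma exec_leq h h' c s t : h <= h' -> exec h c s t -> exec h' c s t.
Proof.
move=> hh; elim; try by [move=> *; constructor; auto | move=> *; econstructor; eauto].
by move=> r b {}s lt; constructor; apply: leq_trans lt hh.
Qed.

(** This turns a space bound into a bound on the size of the output; see [PS_elim]. *)
Lemma exec_fits h c s t : exec h c s t ->
  (forall r, size (get s r) <= h) -> forall r, size (get t r) <= h.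
Proof.
elim=> //; try by auto.
- move=> r b {}s lt H i; rewrite get_upd; case: eqP => //.
- move=> r b l {}s E H i; rewrite get_upd; case: eqP => // _.
  by have := H r; rewrite E /=; apply: ltnW.
Qed.

(** * Compilation of stack programs to Turing machines *)

Inductive instr :=
| IPush (r : reg) (b : bool)
| IPop (r : reg)
| IBranch (r : reg) (p : pred (option bool)) (pc : nat)
| IJump (pc : nat)
| IHalt.

(** Jump targets are absolute, hence the load address [o]. *)
Fixpoint compile (o : nat) (c : cmd) : seq instr :=
  match c with
  | Skip => [::]
  | Push r b => [:: IPush r b]
  | Pop r => [:: IPop r]
  | Seq c1 c2 => let k1 := compile o c1 in k1 ++ compile (o + size k1) c2
  | IfTop r p c1 c2 =>
      let k1 := compile o.+1 c1 in
      let k2 := compile (o + (size k1).+2) c2 in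
      IBranch r p (o + (size k1).+2) :: k1 ++
      IJump (o + (size k1).+2 + size k2) :: k2
  | WhileTop r p c =>
      let k := compile o.+1 c in
      IBranch r p (o + (size k).+2) :: k ++ [:: IJump o]
  end.

Notation sym := (symbol void).
Definition in_sym (b : bool) : sym := Some (inl b).
Definition out_sym (a : sym) : option bool := if a is Some (inl b) then Some b else None.

Section Machine.
Variable code : seq instr.
Let L := size code.

(* [inl (pc, phase)] is about to execute instruction [pc]; a push takes two
   machine steps, the second one in phase [true]. *)
Definition machine_state : Type := ('I_L.+1 * bool) + bool.

(** The address just past the code reads as [IHalt], the default of [nth], so compiled code halts by
    running off its end. Pushing moves the head left before writing; popping erases and moves
    right. *)
Definition machine_delta (q : machine_state) (a : {ffun 'I_4 -> sym}) :
    machine_state * ('I_4 -> sym * direction) :=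
  let idle := fun i => (a i, Stay) in
  let on r x d := fun i : 'I_4 => if i == r then (x, d) else (a i, Stay) in
  match q with
  | inr b => (q, idle)
  | inl (pc, ph) =>
    match nth IHalt code pc with
    | IPush r b => if ph then (inl (inord pc.+1, false), on r (in_sym b) Stay)
                   else (inl (pc, true), on r (a r) GoLeft)
    | IPop r => (inl (inord pc.+1, false), on r None GoRight)
    | IBranch r p pc' =>
        (inl (inord (if p (out_sym (a r)) then pc.+1 else pc'), false), idle)
    | IJump pc' => (inl (inord pc', false), idle)
    | IHalt => (inr (out_sym (a main) == Some true), idle)
    end
  end.

Definition stack_machine : machine :=
  @Machine 3 (('I_L.+1 * bool) + bool)%type void (inl (ord0, false))
    (fun q => if q is inr b then Some b else None) machine_delta.

(** The top of the stack is under the head and the rest lies to its right. The [m] blanks on the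
    left are cells vacated by pops: they still count as space, hence [m + size l <= h]. At most one
    blank is represented below the bottom, namely the one scanned when the stack is empty. *)
Definition repr (h : nat) (l : seq bool) (T : tape sym) : Prop :=
  exists m j, [/\ left_of T = nseq m None,
    scanned T :: right_of T = map in_sym l ++ nseq j None, j <= 1 &
    m + size l <= h].

Definition crepr (h pc : nat) (s : stacks) (c : config stack_machine) : Prop :=
  control c = inl (inord pc, false) /\ forall i : reg, repr h (get s i) (tapes c i).

Definition reach (B : nat) (c c' : config stack_machine) : Prop :=
  exists t, c' = iter t (@step stack_machine) c /\
    forall t', t' <= t -> config_space (iter t' (@step stack_machine) c) <= B.

Lemma reach_refl B c : config_space c <= B -> reach B c c.
Proof. by move=> H; exists 0; split=> // t'; rewrite leqn0 => /eqP ->. Qed.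

Lemma reach_trans B c c1 c2 : reach B c c1 -> reach B c1 c2 -> reach B c c2.
Proof.
move=> [t [-> H]] [t2 [-> H2]]; exists (t2 + t); split; first by rewrite iterD.
move=> t' le; case: (leqP t' t) => [|lt]; first exact: H.
have -> : t' = (t' - t) + t by rewrite subnK // ltnW.
rewrite iterD; apply: H2; lia.
Qed.

Lemma reach_step B c : config_space c <= B -> config_space (@step stack_machine c) <= B ->
  reach B c (@step stack_machine c).
Proof.
by move=> H1 H2; exists 1; split=> // -[|[|//]] _.
Qed.

Lemma repr_space h l T : repr h l T -> tape_space T <= h.+1.
Proof.
case=> m [j [E1 E2 j1 H]]; move/(congr1 size): E2.
rewrite /tape_space E1 /= size_cat size_map !size_nseq; lia.
Qed.

Lemma repr_scanned h l T : repr h l T -> out_sym (scanned T) = ohead l.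
Proof.
case=> m [j [_ E _ _]]; case: l E => [|b l] /=; last by case=> ->.
by case: j => [|j] //= [-> _].
Qed.

Lemma repr_pop h b l T : repr h (b :: l) T ->
  repr h l (tape_move None GoRight (tape_write None T)).
Proof.
case=> m [j [E1 E2 j1 H]]; rewrite /repr /= E1.
move: E2 => /= -[_ E2]; rewrite E2.
case: l H E2 => [|b' l] /= H E2; last first.
  by exists m.+1, j; split=> //; move: H => /=; lia.
exists m.+1, 1; split=> //; last by move: H => /=; lia.
by case: j j1 {H E2} => [|[|]].
Qed.

(** Between the two machine steps of a push the tape need not represent a stack, so its space is
    bounded separately. *)
Lemma repr_push h b l T : repr h l T -> size l < h ->
  let T' := tape_move None GoLeft (tape_write (scanned T) T) in
  tape_space T' <= h.+1 /\ repr h (b :: l) (tape_move None Stay (tape_write (in_sym b) T')).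
Proof.
case=> m [j [E1 E2 j1 H]] lt /=; rewrite /repr /tape_space /= E1 E2.

split; first by move: (congr1 size E2); rewrite /= size_behead size_cat size_map !size_nseq; lia.
exists m.-1, j; split=> //; first by case: m {E1 H}.
rewrite /=; lia.
Qed.

Lemma crepr_space h pc s c : crepr h pc s c -> config_space c <= 4 * h.+1.
Proof.
case=> _ H; rewrite /config_space.
rewrite [leqRHS](_ : _ = \sum_(i < 4) h.+1); last by rewrite sum_nat_const card_ord.
by apply: leq_sum => i _; apply: repr_space (H i).
Qed.

Lemma stepE c : verdict (control c) = None -> @step stack_machine c =
  let r := machine_delta (control c) [ffun i => scanned (tapes c i)] in
  Config (M := stack_machine) r.1
   [ffun i => tape_move None (r.2 i).2 (tape_write (r.2 i).1 (tapes c i))].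
Proof. by move=> H; rewrite /step H /=; case: machine_delta. Qed.

Lemma tape_idle (T : tape sym) : tape_move None Stay (tape_write (scanned T) T) = T.
Proof. by case: T. Qed.

Lemma tape_idle_config (c : config stack_machine) :
  [ffun i => tape_move None Stay (tape_write (scanned (tapes c i)) (tapes c i))] = tapes c.
Proof. by apply/ffunP => i; rewrite ffunE tape_idle. Qed.

Lemma crepr_pop h pc b l s r c : pc < L -> nth IHalt code pc = IPop r ->
  get s r = b :: l -> crepr h pc s c ->
  exists2 c', crepr h pc.+1 (upd r l s) c' & reach (4 * h.+1) c c'.
Proof.
move=> ltL Ei Eg H; have [Ec Ht] := H.
suff H' : crepr h pc.+1 (upd r l s) (@step stack_machine c).
  by exists (@step stack_machine c) => //; apply: reach_step; apply: crepr_space; eassumption.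
rewrite stepE ?Ec //= inordK ?ltnS ?(ltnW ltL) // Ei /=; split=> //= i.
rewrite get_upd !ffunE; case: eqP => [->|_] /=; last by move: (Ht i); case: (tapes c i).
by apply: (repr_pop (b := b)); rewrite -Eg.
Qed.

Lemma crepr_push h pc b s r c : pc < L -> nth IHalt code pc = IPush r b ->
  size (get s r) < h -> crepr h pc s c ->
  exists2 c', crepr h pc.+1 (upd r (b :: get s r) s) c' & reach (4 * h.+1) c c'.
Proof.
move=> ltL Ei lt H; have [Ec Ht] := H.
have [sp rp] := repr_push b (Ht r) lt.
pose c1 := @step stack_machine c.
have E1 : c1 = Config (M := stack_machine) (inl (inord pc, true))
    [ffun i => if i == r then tape_move None GoLeft (tape_write (scanned (tapes c r)) (tapes c r))
               else tapes c i].
  rewrite /c1 stepE ?Ec //= inordK ?ltnS ?(ltnW ltL) // Ei /=; congr Config.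
  apply/ffunP => i; rewrite !ffunE.
  by case: eqP => [->|_] //=; case: (tapes c i).
have sp1 : config_space c1 <= 4 * h.+1.
  rewrite E1 /config_space.
  rewrite [leqRHS](_ : _ = \sum_(i < 4) h.+1); last by rewrite sum_nat_const card_ord.
  apply: leq_sum => i _; rewrite ffunE; case: eqP => // _; exact: repr_space (Ht i).
have H' : crepr h pc.+1 (upd r (b :: get s r) s) (@step stack_machine c1).
  rewrite E1 stepE //= inordK ?ltnS ?(ltnW ltL) // Ei /=; split=> //= i.
  rewrite get_upd !ffunE ?eqxx; case: (i =P r) => [_|_] /=; last by move: (Ht i); case: (tapes c i).
  exact: rp.
exists (@step stack_machine c1) => //; apply: (@reach_trans _ _ c1); apply: reach_step => //.
  exact: crepr_space H.
exact: crepr_space H'.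
Qed.

Lemma crepr_branch h pc p pc' s r c : pc < L -> nth IHalt code pc = IBranch r p pc' ->
  crepr h pc s c ->
  exists2 c', crepr h (if p (ohead (get s r)) then pc.+1 else pc') s c' & reach (4 * h.+1) c c'.
Proof.
move=> ltL Ei H; have [Ec Ht] := H.
suff H' : crepr h (if p (ohead (get s r)) then pc.+1 else pc') s (@step stack_machine c).
  by exists (@step stack_machine c) => //; apply: reach_step; apply: crepr_space; eassumption.
rewrite stepE ?Ec //= inordK ?ltnS ?(ltnW ltL) // Ei /=; split=> /= [|i].
  by rewrite ffunE (repr_scanned (Ht r)).
by rewrite !ffunE; move: (Ht i); case: (tapes c i).
Qed.

Lemma crepr_jump h pc pc' s c : pc < L -> nth IHalt code pc = IJump pc' ->
  crepr h pc s c ->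
  exists2 c', crepr h pc' s c' & reach (4 * h.+1) c c'.
Proof.
move=> ltL Ei H; have [Ec Ht] := H.
suff H' : crepr h pc' s (@step stack_machine c).
  by exists (@step stack_machine c) => //; apply: reach_step; apply: crepr_space; eassumption.
rewrite stepE ?Ec //= inordK ?ltnS ?(ltnW ltL) // Ei /=; split=> //= i.
by rewrite !ffunE; move: (Ht i); case: (tapes c i).
Qed.

Lemma nth_mid pre i post : nth IHalt (pre ++ i :: post) (size pre) = i.
Proof. by rewrite nth_cat ltnn subnn. Qed.

(** Induction on the derivation, with the surrounding code [pre] and [post] left general: the
    subcommands sit in other contexts. *)
Lemma compile_correct h c s t : exec h c s t ->
  forall pre post, code = pre ++ compile (size pre) c ++ post ->
  forall k, crepr h (size pre) s k ->
  exists2 k', crepr h (size pre + size (compile (size pre) c)) t k' & reach (4 * h.+1) k k'.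
Proof.
elim=> {c s t}.
- move=> s pre post _ k H; exists k; first by rewrite addn0.
  exact/reach_refl/(crepr_space H).
- move=> r b s lt pre post /= Ec k H; rewrite addn1.
  apply: crepr_push => //; rewrite ?/L Ec ?nth_mid // !size_cat /=; lia.
- move=> r b l s E pre post /= Ec k H; rewrite addn1.
  apply: crepr_pop E H; rewrite ?/L Ec ?nth_mid // !size_cat /=; lia.
- move=> c1 c2 s t u _ IH1 _ IH2 pre post /= Ec k H.
  set k1 := compile (size pre) c1 in Ec *.
  have [|k' H' R'] := IH1 pre (compile (size pre + size k1) c2 ++ post) _ k H.
    by rewrite Ec /k1 -catA.
  have [||k2 H2 R2] := IH2 (pre ++ k1) post _ k' _; rewrite ?size_cat //.
    by rewrite Ec !catA.
  by exists k2; [move: H2; rewrite !size_cat addnA | apply: reach_trans R' R2].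
- move=> r p c1 c2 s t pT _ IH pre post /= Ec k H.
  set k1 := compile _ c1 in Ec *; set k2 := compile _ c2 in Ec *.
  have [||k' H' R'] := crepr_branch (r := r) (p := p) (pc' := size pre + (size k1).+2) _ _ H.
  - by rewrite /L Ec !size_cat /= !size_cat /=; lia.
  - by rewrite Ec nth_mid.
  rewrite pT in H'.
  have [||k3 H3 R3] := IH (rcons pre (IBranch r p (size pre + (size k1).+2)))
     (IJump (size pre + (size k1).+2 + size k2) :: k2 ++ post) _ k' _; rewrite ?size_rcons //.
    by rewrite Ec cat_rcons /= -catA.
  rewrite size_rcons -/k1 in H3.
  have [||k4 H4 R4] := crepr_jump (pc' := size pre + (size k1).+2 + size k2) _ _ H3.
  - by rewrite /L Ec !size_cat /= !size_cat /=; lia.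
  - rewrite Ec /= -catA /= -cat_rcons catA.
    have -> : (size pre).+1 + size k1 =
        size (rcons pre (IBranch r p (size pre + (size k1).+2)) ++ k1).
      by rewrite size_cat size_rcons.
    by rewrite nth_mid.
  exists k4; last by apply: reach_trans R' _; apply: reach_trans R3 R4.
  by rewrite size_cat /= (_ : size pre + _ = size pre + (size k1).+2 + size k2) //; lia.
- move=> r p c1 c2 s t pF _ IH pre post /= Ec k H.
  set k1 := compile _ c1 in Ec *; set k2 := compile _ c2 in Ec *.
  have [||k' H' R'] := crepr_branch (r := r) (p := p) (pc' := size pre + (size k1).+2) _ _ H.
  - by rewrite /L Ec !size_cat /= !size_cat /=; lia.
  - by rewrite Ec nth_mid.
  rewrite (negbTE pF) in H'.
  set pre2 := rcons (rcons pre (IBranch r p (size pre + (size k1).+2)) ++ k1)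
     (IJump (size pre + (size k1).+2 + size k2)).
  have sz2 : size pre2 = size pre + (size k1).+2.
    by rewrite size_rcons size_cat size_rcons; lia.
  have [||k3 H3 R3] := IH pre2 post _ k' _; rewrite ?sz2 //.
    by rewrite Ec /pre2 /= -/k2 cat_rcons -catA cat_rcons /= -catA.
  exists k3; last by apply: reach_trans R' R3.
  rewrite sz2 -/k2 in H3.
  by rewrite size_cat /= (_ : size pre + _ = size pre + (size k1).+2 + size k2) //; lia.
- move=> r p c s t u pT _ IH1 _ IH2 pre post /= Ec k H.
  set k1 := compile _ c in Ec *.
  have [||k' H' R'] := crepr_branch (r := r) (p := p) (pc' := size pre + (size k1).+2) _ _ H.
  - by rewrite /L Ec !size_cat /= !size_cat /=; lia.
  - by rewrite Ec nth_mid.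
  rewrite pT in H'.
  have [||k3 H3 R3] := IH1 (rcons pre (IBranch r p (size pre + (size k1).+2)))
     (IJump (size pre) :: post) _ k' _; rewrite ?size_rcons //.
    by rewrite Ec cat_rcons /= -catA.
  rewrite size_rcons -/k1 in H3.
  have [||k4 H4 R4] := crepr_jump (pc' := size pre) _ _ H3.
  - by rewrite /L Ec !size_cat /= !size_cat /=; lia.
  - rewrite Ec /= -catA /= -cat_rcons catA.
    have -> : (size pre).+1 + size k1 =
        size (rcons pre (IBranch r p (size pre + (size k1).+2)) ++ k1).
      by rewrite size_cat size_rcons.
    by rewrite nth_mid.
  (* The jump has returned to the first instruction of the loop, so the remaining iterations run the
     same code at the same address. *)
  have [|k5 H5 R5] := IH2 pre post _ k4 H4; first by rewrite Ec.
  exists k5; first exact: H5.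
  by apply: reach_trans R' _; apply: reach_trans R3 _; apply: reach_trans R4 R5.
- move=> r p c s pF pre post /= Ec k H.
  set k1 := compile _ c in Ec *.
  have [||k' H' R'] := crepr_branch (r := r) (p := p) (pc' := size pre + (size k1).+2) _ _ H.
  - by rewrite /L Ec !size_cat /= !size_cat /=; lia.
  - by rewrite Ec nth_mid.
  rewrite (negbTE pF) in H'; exists k' => //.
  by rewrite size_cat /= addn1.
Qed.

End Machine.

Lemma SPACE_stack_program (L : language) (c : cmd) (h f : nat -> nat) :
  (forall w, exists b s, [/\ size w <= h (size w),
     exec (h (size w)) c (Stacks w [::] [::] [::]) s, ohead (get s main) = Some b
     & b = true <-> L w]) ->
  (exists a, forall m, 4 * (h m).+1 <= a * f m + a) ->
  SPACE f L.
Proof.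
move=> H [a Ha].
pose M := stack_machine (compile 0 c); exists M.
suff K w : exists t b, verdict (control (run M w t)) = Some b /\ (b = true <-> L w) /\
   forall t', config_space (run M w t') <= 4 * (h (size w)).+1.
  split; first by move=> w; have [t [b [H1 [H2 _]]]] := K w; exists t, b.
  exists a => w t; have [_ [_ [_ [_ H1]]]] := K w.
  exact: leq_trans (H1 t) (Ha _).
have [b [s [sw Hx Hb HL]]] := H w.
have [||k' [Ck Tk] [t [Et Ht]]] := @compile_correct (compile 0 c) _ _ _ _ Hx [::] [::] _ (initial M w).
- by rewrite cats0.
- split; first by rewrite /=; congr (inl (_, _)); apply: val_inj; rewrite /= inordK.
  move=> i; rewrite ffunE; case: i => [[|[|[|[|i]]]] // Hi] /=.
  (* On the empty input the scanned cell is already a blank. *)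
  + exists 0, (size w == 0); rewrite /input_tape; split=> //=.
    by case: (w) => [|b' w'] //=; rewrite cats0.
    by case: (w).
  + by exists 0, 1; split.
  + by exists 0, 1; split.
  + by exists 0, 1; split.
exists t.+1, b; split; last split=> //.
  rewrite /run iterS -Et stepE ?Ck //= add0n inordK // nth_default //=.
  by rewrite ffunE (repr_scanned (Tk main)) Hb; case: b {Hb HL}.
(* [SPACE] bounds the configurations at all times. After the halting step the configuration is
   constant and has the tapes of [k']. *)
move=> t'; case: (leqP t' t) => [/Ht //|lt].
have Hend : crepr (h (size w)) (0 + size (compile 0 c)) s k' by split.
pose k2 := @step M k'.
have Ek2 : k2 = Config (M := M) (inr b) (tapes k').
  rewrite /k2 stepE ?Ck //= add0n inordK // nth_default //=.
  rewrite ffunE (repr_scanned (Tk main)) Hb; congr Config; first by case: b {Hb HL}.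
  by rewrite -[RHS]tape_idle_config; apply/ffunP => i; rewrite !ffunE.
have fixk n : iter n (@step M) k2 = k2.
  by elim: n => //= n ->; rewrite Ek2.
have -> : t' = (t' - t.+1) + t.+1 by rewrite subnK.
rewrite /run iterD iterS -Et -/k2 fixk Ek2.
exact: (crepr_space Hend).
Qed.

(** * Trees on a stack *)

Arguments get s i /.

Inductive tree := Leaf | Node (l r : tree).

(** Prefix notation delimits itself: a reader can stop at the end of a tree whatever lies below it,
    and pushing [true] on two adjacent trees joins them into a node. *)
Fixpoint code (t : tree) : seq bool :=
  if t is Node l r then true :: code l ++ code r else [:: false].

Notation tsz t := (size (code t)).

Definition nonempty : pred (option bool) := isSome.
Definition top_true : pred (option bool) := fun o => o == Some true.

Definition While_nonempty r c := WhileTop r nonempty c.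
Definition If_true r c1 c2 := IfTop r top_true c1 c2.

(* [ctr] holds one bit per tree still to be read. *)
Definition move_tree (dst : reg) : cmd :=
  Seq (Push ctr true)
   (While_nonempty ctr (Seq (Pop ctr)
     (If_true main
       (Seq (Pop main) (Seq (Push dst true) (Seq (Push ctr true) (Push ctr true))))
       (Seq (Pop main) (Push dst false))))).

Definition move_all (src dst : reg) : cmd :=
  While_nonempty src
    (If_true src (Seq (Pop src) (Push dst true)) (Seq (Pop src) (Push dst false))).

Lemma EIfB h r c1 c2 s t b : ohead (get s r) = Some b ->
  exec h (if b then c1 else c2) s t -> exec h (If_true r c1 c2) s t.
Proof. by case: b => E H; [apply: EIfT | apply: EIfF] => //; rewrite E. Qed.

(** The boolean [z] chooses the destination, [d] is what it already holds and [o] is the content of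
    the other scratch stack. *)
Lemma move_treeP h z t r d o : size (code t) + size d <= h -> (tsz t).+1 <= h ->
  exec h (move_tree (if z then inp else aux))
    (if z then Stacks d (code t ++ r) o [::] else Stacks o (code t ++ r) d [::])
    (if z then Stacks (rev (code t) ++ d) r o [::] else Stacks o r (rev (code t) ++ d) [::]).
Proof.
move=> hd hc; apply: ESeq.
  by apply: EPush; case: (z) => /=; lia.
rewrite /While_nonempty; set body := WhileTop _ _ _.
(* Generalised to further pending trees [c]: reading a node replaces one pending tree by two, and
   the induction is on the tree. *)
suff K : forall c s, size (code t) + size d <= h -> (tsz t + size c).+1 <= h ->
   exec h body (if z then Stacks (rev (code t) ++ d) r o c
      else Stacks o r (rev (code t) ++ d) c) s ->
   exec h body (if z then Stacks d (code t ++ r) o (true :: c)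
      else Stacks o (code t ++ r) d (true :: c)) s.
  rewrite (_ : upd _ _ _ = if z then Stacks d (code t ++ r) o [:: true]
      else Stacks o (code t ++ r) d [:: true]); last by case: (z).
  apply: K => //; first by rewrite /= addn0.
  by apply: EWhileF; case: (z).
elim: t r d {hd hc} => [|t1 IH1 t2 IH2] r d c s hd hc H.
  apply: EWhileT H; first by case: (z).
  apply: ESeq; first by apply: EPop; case: (z).
  apply: (@EIfB _ _ _ _ _ _ false); first by case: (z).
  apply: ESeq; first by apply: EPop; case: (z).
  move: hd hc; rewrite /=; case: (z) => hd hc; apply: EPush => /=; lia.
move: hd hc H; rewrite /= size_cat => hd hc H.
apply: (@EWhileT _ _ _ _ _
   (if z then Stacks (true :: d) (code t1 ++ code t2 ++ r) o (true :: true :: c)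
    else Stacks o (code t1 ++ code t2 ++ r) (true :: d) (true :: true :: c))); first by case: (z).
  apply: ESeq; first by apply: EPop; case: (z).
  apply: (@EIfB _ _ _ _ _ _ true); first by case: (z).
  apply: ESeq; first by apply: EPop; case: (z).
  rewrite catA; case: (z); apply: ESeq; first by apply: EPush => /=; lia.
  - by apply: ESeq; [apply: EPush | apply: EPush]; rewrite /=; lia.
  - by apply: EPush => /=; lia.
  - by apply: ESeq; [apply: EPush | apply: EPush]; rewrite /=; lia.
apply: IH1 => /=; try lia.
apply: IH2; rewrite ?size_cat ?size_rev /=; try lia.
by rewrite catA -rev_cat -cat_rcons -rev_cons.
Qed.

Lemma move_tree_inpP h t r d o : size (code t) + size d <= h -> (tsz t).+1 <= h ->
  exec h (move_tree inp) (Stacks d (code t ++ r) o [::]) (Stacks (rev (code t) ++ d) r o [::]).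
Proof. exact: (@move_treeP h true). Qed.

Lemma move_tree_auxP h t r d o : size (code t) + size d <= h -> (tsz t).+1 <= h ->
  exec h (move_tree aux) (Stacks o (code t ++ r) d [::]) (Stacks o r (rev (code t) ++ d) [::]).
Proof. exact: (@move_treeP h false). Qed.

Lemma move_all_12 h a m x c : size x + size a <= h ->
  exec h (move_all aux inp) (Stacks a m x c) (Stacks (catrev x a) m [::] c).
Proof.
elim: x a => [|b x IH] a H; first exact: EWhileF.
apply: (@EWhileT _ _ _ _ _ (Stacks (b :: a) m x c)) => //.
  move: H => /= H; apply: (EIfB (b := b)) => //; case: b; apply: ESeq; first exact: EPop.
  - by apply: EPush => /=; lia.
  - exact: EPop.
  - by apply: EPush => /=; lia.
by apply: IH; move: H => /=; lia.
Qed.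

Lemma move_all_21 h a m x c : size a + size x <= h ->
  exec h (move_all inp aux) (Stacks a m x c) (Stacks [::] m (catrev a x) c).
Proof.
elim: a x => [|b a IH] x H; first exact: EWhileF.
apply: (@EWhileT _ _ _ _ _ (Stacks a m (b :: x) c)) => //.
  move: H => /= H; apply: (EIfB (b := b)) => //; case: b; apply: ESeq; first exact: EPop.
  - by apply: EPush => /=; lia.
  - exact: EPop.
  - by apply: EPush => /=; lia.
by apply: IH; move: H => /=; lia.
Qed.

Lemma move_all_1m h a m x c : size a + size m <= h ->
  exec h (move_all inp main) (Stacks a m x c) (Stacks [::] (catrev a m) x c).
Proof.
elim: a m => [|b a IH] m H; first exact: EWhileF.
apply: (@EWhileT _ _ _ _ _ (Stacks a (b :: m) x c)) => //.
  move: H => /= H; apply: (EIfB (b := b)) => //; case: b; apply: ESeq; first exact: EPop.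
  - by apply: EPush => /=; lia.
  - exact: EPop.
  - by apply: EPush => /=; lia.
by apply: IH; move: H => /=; lia.
Qed.

Lemma move_all_2m h a m x c : size x + size m <= h ->
  exec h (move_all aux main) (Stacks a m x c) (Stacks a (catrev x m) [::] c).
Proof.
elim: x m => [|b x IH] m H; first exact: EWhileF.
apply: (@EWhileT _ _ _ _ _ (Stacks a (b :: m) x c)) => //.
  move: H => /= H; apply: (EIfB (b := b)) => //; case: b; apply: ESeq; first exact: EPop.
  - by apply: EPush => /=; lia.
  - exact: EPop.
  - by apply: EPush => /=; lia.
by apply: IH; move: H => /=; lia.
Qed.

Definition clear_inp : cmd := While_nonempty inp (Pop inp).

Lemma clear_inpP h a m x c : exec h clear_inp (Stacks a m x c) (Stacks [::] m x c).
Proof.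
elim: a => [|b a IH]; first exact: EWhileF.
by apply: (@EWhileT _ _ _ _ _ (Stacks a m x c)) => //; apply: EPop.
Qed.

Definition copy_all : cmd :=
  While_nonempty inp (If_true inp
     (Seq (Pop inp) (Seq (Push main true) (Push aux true)))
     (Seq (Pop inp) (Seq (Push main false) (Push aux false)))).

Lemma copy_allP h a m x c : size a + size m <= h -> size a + size x <= h ->
  exec h copy_all (Stacks a m x c) (Stacks [::] (catrev a m) (catrev a x) c).
Proof.
elim: a m x => [|b a IH] m x H H'; first exact: EWhileF.
apply: (@EWhileT _ _ _ _ _ (Stacks a (b :: m) (b :: x) c)) => //.
  move: H H' => /= H H'; apply: (EIfB (b := b)) => //; case: b; apply: ESeq; try exact: EPop.
  - by apply: ESeq; [apply: EPush | apply: EPush]; rewrite /=; lia.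
  - by apply: ESeq; [apply: EPush | apply: EPush]; rewrite /=; lia.
by apply: IH; move: H H' => /=; lia.
Qed.

Notation mainst m := (Stacks [::] m [::] [::]).

Definition drop_tree := Seq (move_tree inp) clear_inp.
(** Each transfer reverses the word, so the copy left on [aux] returns to [main] by way of [inp] to
    keep its orientation. *)
Definition dup_tree :=
  Seq (move_tree inp) (Seq copy_all (Seq (move_all aux inp) (move_all inp main))).
Definition swap_tree :=
  Seq (move_tree inp) (Seq (move_tree aux) (Seq (move_all inp main) (move_all aux main))).

Lemma drop_treeP h t r : (tsz t).+1 <= h -> exec h drop_tree (mainst (code t ++ r)) (mainst r).
Proof.
move=> H; apply: ESeq; last exact: (@clear_inpP _ (rev (code t) ++ [::])).
by apply: move_tree_inpP; rewrite //= addn0 ltnW.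
Qed.

Lemma catrev_rev T (x y : seq T) : catrev (rev x) y = x ++ y.
Proof. by rewrite catrevE revK. Qed.

Lemma dup_treeP h t r : (tsz t + tsz t + size r).+1 <= h ->
  exec h dup_tree (mainst (code t ++ r)) (mainst (code t ++ code t ++ r)).
Proof.
move=> H; apply: ESeq.
  by apply: move_tree_inpP; rewrite //=; lia.
rewrite cats0; apply: ESeq.
  by apply: copy_allP; rewrite !size_rev /=; lia.
rewrite !catrev_rev cats0; apply: ESeq.
  by apply: move_all_12 => /=; lia.
rewrite -[in X in exec _ _ _ X]catrev_rev -[catrev _ _]/(rev _); apply: move_all_1m.
by rewrite size_rev size_cat; lia.
Qed.

Lemma swap_treeP h t u r : (tsz t + tsz u + size r).+1 <= h ->
  exec h swap_tree (mainst (code t ++ code u ++ r)) (mainst (code u ++ code t ++ r)).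
Proof.
move=> H; apply: ESeq.
  by apply: move_tree_inpP; rewrite //=; lia.
rewrite cats0; apply: ESeq.
  by apply: move_tree_auxP; rewrite //=; lia.
rewrite cats0; apply: ESeq.
  by apply: move_all_1m; rewrite size_rev; lia.
rewrite !catrev_rev -[in X in exec _ _ _ X]catrev_rev; apply: move_all_2m.
by rewrite size_cat !size_rev; lia.
Qed.

Lemma tsz_gt0 t : 0 < tsz t. Proof. by case: t. Qed.

(** * Polynomial bounds *)

(** A base of at least 2 lets the exponent absorb constants and sums, even at [m = 0]. *)
Definition poly (g : nat -> nat) := exists k, forall m, g m <= m.+2 ^ k.

Lemma poly_le g g' : (forall m, g m <= g' m) -> poly g' -> poly g.
Proof. by move=> H [k Hk]; exists k => m; apply: leq_trans (H m) (Hk m). Qed.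

Lemma expS_le m k l : k <= l -> m.+2 ^ k <= m.+2 ^ l.
Proof. by move=> H; rewrite leq_exp2l. Qed.

Lemma poly_const c : poly (fun _ => c).
Proof.
exists c => m; apply: leq_trans (ltnW (ltn_expl c (isT : 1 < 2))) _.
by case: c => // c; rewrite leq_exp2r.
Qed.

Lemma poly_id : poly (fun m => m).
Proof. by exists 1 => m; rewrite expn1; lia. Qed.

Lemma poly_add f g : poly f -> poly g -> poly (fun m => f m + g m).
Proof.
move=> [k Hk] [l Hl]; exists (k + l).+1 => m.
have H1 := leq_trans (Hk m) (expS_le m (leq_addr l k)).
have H2 := leq_trans (Hl m) (expS_le m (leq_addl k l)).
rewrite expnS; set X := m.+2 ^ _ in H1 H2 *; nia.
Qed.

Lemma poly_mul f g : poly f -> poly g -> poly (fun m => f m * g m).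
Proof. by move=> [k Hk] [l Hl]; exists (k + l) => m; rewrite expnD leq_mul. Qed.

Lemma poly_comp f k : poly f -> poly (fun m => (f m).+2 ^ k).
Proof.
move=> [l Hl]; exists (l.+2 * k) => m; rewrite expnM.
case: k => // k; rewrite leq_exp2r //; have := Hl m; rewrite !expnS.
set X := m.+2 ^ l; have : 0 < X by rewrite expn_gt0.
nia.
Qed.

Lemma poly_exp k : poly (fun m => m.+2 ^ k).
Proof. by exists k. Qed.

Ltac poly := repeat first
  [ apply: poly_const | apply: poly_id | apply: poly_exp | apply: poly_comp
  | apply: poly_mul | apply: poly_add ].

(** * Polynomial-space functions *)

Class Enc (A : Type) := enc : A -> tree.

Definition esz (A : Type) {E : Enc A} (a : A) : nat := tsz (enc a).

(** The lower part [r] of the stack is arbitrary, is preserved, and enters the bound only through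
    its size. *)
Definition PS (A B : Type) {EA : Enc A} {EB : Enc B} (f : A -> B) : Prop :=
  exists c k, forall a r, exec (size r + (esz a).+2 ^ k) c
     (mainst (code (enc a) ++ r)) (mainst (code (enc (f a)) ++ r)).

Section Basic.
Context {A B : Type} {EA : Enc A} {EB : Enc B}.

Lemma PS_intro c g (f : A -> B) : poly g ->
  (forall a r, exec (size r + g (esz a)) c
     (mainst (code (enc a) ++ r)) (mainst (code (enc (f a)) ++ r))) -> PS f.
Proof.
move=> [k Hk] H; exists c, k => a r; apply: exec_leq (H a r).
by rewrite leq_add2l.
Qed.

(** The output obeys the height bound by [exec_fits]; the exponent is raised by one so that the
    input obeys it too. *)
Lemma PS_elim (f : A -> B) : PS f -> exists c k, forall a,
  esz (f a) <= (esz a).+2 ^ k /\ forall r, exec (size r + (esz a).+2 ^ k) c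
     (mainst (code (enc a) ++ r)) (mainst (code (enc (f a)) ++ r)).
Proof.
move=> [c [k H]]; exists c, k.+1 => a; split.
  have le : esz a <= (esz a).+2 ^ k.+1.
    by rewrite expnS; have : 0 < (esz a).+2 ^ k by [rewrite expn_gt0]; nia.
  have := exec_fits (exec_leq (h' := (esz a).+2 ^ k.+1) _ (H a [::])) _ main.
  rewrite /= !cats0 add0n; apply; first by rewrite expS_le.
  by move=> [[|[|[|[|i]]]] // Hi] /=.
by move=> r; apply: exec_leq (H a r); rewrite leq_add2l expS_le.
Qed.

Lemma PS_recode (f : A -> B) : (forall a, enc (f a) = enc a) -> PS f.
Proof.
by move=> H; apply: (@PS_intro Skip (fun _ => 0)); [poly | move=> a r; rewrite H; constructor].
Qed.

Lemma PS_eq (f g : A -> B) : (forall a, f a = g a) -> PS f -> PS g.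
Proof. by move=> H [c [k K]]; exists c, k => a r; rewrite -H. Qed.

Fixpoint push_all (l : seq bool) : cmd :=
  if l is b :: l' then Seq (push_all l') (Push main b) else Skip.

Lemma push_allP h l m : size l + size m <= h -> exec h (push_all l) (mainst m) (mainst (l ++ m)).
Proof.
elim: l m => [|b l IH] m /= H; first exact: ESkip.
by apply: ESeq; [apply: IH; lia | apply: EPush; rewrite /= size_cat; lia].
Qed.

Lemma PS_const (b : B) : PS (fun _ : A => b).
Proof.
apply: (@PS_intro (Seq drop_tree (push_all (code (enc b)))) (fun m => m + (1 + esz b))); first by poly.
move=> a r; apply: ESeq; first by apply: drop_treeP; rewrite /esz; lia.
by apply: push_allP; rewrite /esz; lia.
Qed.

End Basic.

Lemma leq_exp_mono m m' k : m <= m' -> m.+2 ^ k <= m'.+2 ^ k.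
Proof. by case: k => // k H; rewrite leq_exp2r. Qed.

Lemma PS_comp {A B C : Type} {EA : Enc A} {EB : Enc B} {EC : Enc C}
    (g : B -> C) (f : A -> B) :
  PS g -> PS f -> PS (fun a => g (f a)).
Proof.
move=> /PS_elim [cg [k Hg]] /PS_elim [cf [l Hf]].
apply: (@PS_intro _ _ _ _ (Seq cf cg) (fun m => m.+2 ^ l + (m.+2 ^ l).+2 ^ k)); first by poly.
move=> a r; have [sf ef] := Hf a; have [sg eg] := Hg (f a).
apply: ESeq; first by apply: exec_leq (ef r); lia.
apply: exec_leq (eg r); rewrite leq_add2l; apply: leq_trans (leq_addl _ _).
exact: leq_exp_mono.
Qed.

Global Instance enc_pair A B {EA : Enc A} {EB : Enc B} : Enc (A * B) :=
  fun p => Node (enc p.1) (enc p.2).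
Global Instance enc_unit : Enc unit := fun _ => Leaf.
(** The first bit of the code is the boolean itself, so [If_true] can test it. *)
Global Instance enc_bool : Enc bool := fun b => if b then Node Leaf Leaf else Leaf.
(** A number has the tree of the list of that many units, so [PS_recode] reduces arithmetic to
    lists. *)
Global Instance enc_nat : Enc nat := fix f n := if n is n'.+1 then Node Leaf (f n') else Leaf.
Global Instance enc_seq A {EA : Enc A} : Enc (seq A) :=
  fix f l := if l is a :: l' then Node (enc a) (f l') else Leaf.

Lemma esz_gt0 A {EA : Enc A} (a : A) : 0 < esz a. Proof. exact: tsz_gt0. Qed.
Lemma esz_pair A B {EA : Enc A} {EB : Enc B} (p : A * B) : esz p = (esz p.1 + esz p.2).+1.
Proof. by rewrite /esz /= size_cat. Qed.
Lemma esz_bool (b : bool) : esz b <= 3. Proof. by case: b. Qed.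
Lemma esz_nat n : esz n = n.*2.+1.
Proof. by elim: n => // n IH; rewrite doubleS -IH. Qed.
Lemma esz_nil A {EA : Enc A} : esz (@nil A) = 1. Proof. by []. Qed.
Lemma esz_cons A {EA : Enc A} (a : A) l : esz (a :: l) = (esz a + esz l).+1.
Proof. by rewrite /esz /= size_cat. Qed.

Section Comb.
Context {A B C D : Type} {EA : Enc A} {EB : Enc B} {EC : Enc C} {ED : Enc D}.

Lemma PS_id : PS (fun a : A => a).
Proof. exact: PS_recode. Qed.

(** Two copies of the argument are made; each program runs while the other copy, or the other
    result, waits below it. The last [Push] joins the results. *)
Lemma PS_pair (f : A -> B) (g : A -> C) : PS f -> PS g -> PS (fun a => (f a, g a)).
Proof.
move=> /PS_elim [cf [l Hf]] /PS_elim [cg [k Hg]].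
apply: (@PS_intro _ _ _ _ (Seq dup_tree (Seq cf (Seq swap_tree (Seq cg (Seq swap_tree (Push main true))))))
   (fun m => (m + m + 1) + (m + m.+2 ^ l + 1) + (m.+2 ^ l + m.+2 ^ k + 1) + 1)); first by poly.
move=> a r; have [sf ef] := Hf a; have [sg eg] := Hg a.
have {}ef := ef (code (@enc A EA a) ++ r); have {}eg := eg (code (@enc B EB (f a)) ++ r).
rewrite !size_cat in ef eg.
apply: ESeq; first by apply: dup_treeP; rewrite /esz; lia.
apply: ESeq; first by apply: exec_leq ef; rewrite /esz; lia.
apply: ESeq; first by apply: swap_treeP; move: sf; rewrite /esz; lia.
apply: ESeq; first by apply: exec_leq eg; move: sf; rewrite /esz; lia.
apply: ESeq; first by apply: swap_treeP; move: sf sg; rewrite /esz; lia.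
rewrite /= -catA; apply: EPush; rewrite /= !size_cat; move: sf sg; rewrite /esz; lia.
Qed.

Lemma PS_fst' : PS (fun p : A * B => p.1).
Proof.
apply: (@PS_intro _ _ _ _ (Seq (Pop main) (Seq swap_tree drop_tree)) (fun m => m + 1)); first by poly.
move=> [a b] r; rewrite esz_pair /= -catA.
apply: ESeq; first exact: EPop.
apply: ESeq; first by apply: swap_treeP; rewrite /esz; lia.
by apply: drop_treeP; rewrite /esz; lia.
Qed.

Lemma PS_snd' : PS (fun p : A * B => p.2).
Proof.
apply: (@PS_intro _ _ _ _ (Seq (Pop main) drop_tree) (fun m => m + 1)); first by poly.
move=> [a b] r; rewrite esz_pair /= -catA.
apply: ESeq; first exact: EPop.
by apply: drop_treeP; rewrite /esz; lia.
Qed.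

Lemma PS_if (b : A -> bool) (f g : A -> B) : PS b -> PS f -> PS g ->
  PS (fun a => if b a then f a else g a).
Proof.
move=> /PS_elim [cb [j Hb]] /PS_elim [cf [l Hf]] /PS_elim [cg [k Hg]].
apply: (@PS_intro _ _ _ _ (Seq dup_tree (Seq cb (If_true main (Seq drop_tree cf) (Seq drop_tree cg))))
   (fun m => (m + m + 1) + (m + m.+2 ^ j) + m.+2 ^ l + m.+2 ^ k + 4)); first by poly.
move=> a r; have [sf ef] := Hf a; have [sg eg] := Hg a; have [sb eb] := Hb a.
have {}eb := eb (code (@enc A EA a) ++ r); have {}ef := ef r; have {}eg := eg r.
rewrite !size_cat in eb.
apply: ESeq; first by apply: dup_treeP; rewrite /esz; lia.
apply: ESeq; first by apply: exec_leq eb; rewrite /esz; lia.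
apply: (EIfB (b := b a)); first by case: (b a).
case: (b a) sb => sb; apply: ESeq.
- by apply: drop_treeP; rewrite /=; lia.
- by apply: exec_leq ef; rewrite /esz; lia.
- by apply: drop_treeP; rewrite /=; lia.
- by apply: exec_leq eg; rewrite /esz; lia.
Qed.

End Comb.

Section Comb2.
Context {A B C : Type} {EA : Enc A} {EB : Enc B} {EC : Enc C}.

Lemma PS_cons (f : A -> B) (g : A -> seq B) :
  PS f -> PS g -> PS (fun a => f a :: g a).
Proof.
move=> Hf Hg; refine (PS_comp (g := fun p : B * seq B => p.1 :: p.2) _ (PS_pair Hf Hg)).
exact: PS_recode.
Qed.

(** A nonempty list has the same tree as the pair of its head and its tail, so joining the context
    with the list gives the argument of [g] without unpacking. *)
Lemma PS_match (l : A -> seq B) (f : A -> C) (g : A -> B -> seq B -> C) :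
  PS l -> PS f -> PS (fun z : A * (B * seq B) => g z.1 z.2.1 z.2.2) ->
  PS (fun a => if l a is b :: l' then g a b l' else f a).
Proof.
move=> /PS_elim [cl [j Hl]] /PS_elim [cf [i Hf]] /PS_elim [cg [k Hg]].
apply: (@PS_intro _ _ _ _ (Seq dup_tree (Seq cl (If_true main
      (Seq swap_tree (Seq (Push main true) cg)) (Seq drop_tree cf))))
   (fun m => (m + m + 1) + (m + m.+2 ^ j + 1) + m.+2 ^ i + (m + m.+2 ^ j + 1).+2 ^ k + 4)).
  by poly.
move=> a r; have [sl el] := Hl a; have [sf ef] := Hf a.
have {}el := el (code (@enc A EA a) ++ r); have {}ef := ef r.
rewrite !size_cat in el.
apply: ESeq; first by apply: dup_treeP; rewrite /esz; lia.
apply: ESeq; first by apply: exec_leq el; rewrite /esz; lia.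
case: (l a) sl => [|b l'] sl {el}.
  apply: (EIfB (b := false)) => //; apply: ESeq.
    by apply: drop_treeP; rewrite /=; lia.
  by apply: exec_leq ef; rewrite /esz; lia.
apply: (EIfB (b := true)) => //.
have [sg eg] := Hg (a, (b, l')); have {}eg := eg r.
apply: ESeq; first by apply: swap_treeP; move: sl; rewrite /esz; lia.
apply: ESeq.
  by apply: EPush; move: sl; rewrite /= -/(enc l') !size_cat /esz /= -/(enc l') !size_cat; lia.
rewrite [X in exec _ _ X _](_ : _ = mainst (code (enc (a, (b, l'))) ++ r)); last first.
  by rewrite /= -!catA cat_cons -catA.
apply: exec_leq eg; rewrite leq_add2l.
apply: leq_trans (leq_addr _ _); apply: leq_trans (leq_addl _ _); apply: leq_exp_mono.
by move: sl; rewrite esz_cons !esz_pair /=; lia.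
Qed.

(** The size of every value on the way is at most [M], while the number of iterations is
    unrestricted: space is bounded, time is not. *)
Inductive loop (b : A -> bool) (f : A -> A) (M : nat) : A -> A -> Prop :=
| loop_refl a : esz a <= M -> loop b f M a a
| loop_step a c : esz a <= M -> b a -> loop b f M (f a) c -> loop b f M a c.

Lemma loop_trans b f M a c d : loop b f M a c -> loop b f M c d -> loop b f M a d.
Proof. by elim=> // a' c' s Hb _ IH H; apply: loop_step => //; apply: IH. Qed.

(** The bound [p] refers to the input [x], not to the previous value; otherwise it would compound
    over the iterations. *)
Lemma PS_while b f (i : B -> A) (g : B -> A) p : PS b -> PS f -> PS i -> poly p ->
  (forall x, loop b f (p (esz x)) (i x) (g x) /\ ~~ b (g x)) -> PS g.
Proof.
move=> /PS_elim [cb [j Hb]] /PS_elim [cf [l Hf]] /PS_elim [ci [k Hi]] Pp H.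
pose test := Seq dup_tree cb.
pose hh m := (m + m + 1) + (m + m.+2 ^ j) + m.+2 ^ l + 4.
have tst (a : A) r h : size r + hh (esz a) <= h ->
    exec h test (mainst (code (enc a) ++ r)) (mainst (code (enc (b a)) ++ code (enc a) ++ r)).
  move=> hh'; apply: ESeq; first by apply: dup_treeP; move: hh'; rewrite /hh /esz; lia.
  have [_ eb] := Hb a; apply: exec_leq (eb _); rewrite size_cat; move: hh'; rewrite /hh /esz; lia.
pose wh := WhileTop main top_true (Seq drop_tree (Seq cf test)).
apply: (@PS_intro _ _ _ _ (Seq ci (Seq test (Seq wh drop_tree)))
    (fun m => m.+2 ^ k + ((p m + p m + 1) + (p m + (p m).+2 ^ j) + (p m).+2 ^ l + 4))).
  by poly.
move=> x r; have [{}H nb] := H x; have [si ei] := Hi x.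
set M := p (esz x) in H *; rewrite -[X in size r + (_ + X)]/(hh M); set h := size r + _.
have hM (a : A) : esz a <= M -> size r + hh (esz a) <= h.
  move=> le; rewrite leq_add2l; apply: leq_trans (leq_addl _ _).
  rewrite /hh; repeat (apply: leq_add => //); exact: leq_exp_mono.
have Lh (a c : A) : loop b f M a c -> esz a <= M /\ forall s,
   exec h wh (mainst (code (enc (b c)) ++ code (enc c) ++ r)) s ->
   exec h wh (mainst (code (enc (b a)) ++ code (enc a) ++ r)) s.
  elim=> {a c} [a|a c] le; first by split.
  move=> ba _ [le' IH]; split=> // s /IH Hs.
  apply: EWhileT Hs; first by rewrite ba.
  have := hM _ le; rewrite /hh => h1.
  apply: ESeq; first by apply: drop_treeP; rewrite ba /=; lia.
  apply: ESeq; last by apply: tst; apply: hM.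
  have [_ ef] := Hf a; apply: exec_leq (ef r); lia.
have {Lh} [le0 Lh] := Lh _ _ H.
have le1 : esz (g x) <= M by elim: H.
apply: ESeq; first by apply: exec_leq (ei r); rewrite /h; lia.
apply: ESeq; first by apply: tst; apply: hM.
apply: ESeq; first by apply: Lh; apply: EWhileF; case: (b (g x)) nb.
by rewrite (negbTE nb); apply: (@drop_treeP _ Leaf); rewrite /h /hh /=; lia.
Qed.

End Comb2.

(** * List operations in polynomial space *)

Lemma esz_cat A {EA : Enc A} (l1 l2 : seq A) : (esz (l1 ++ l2)).+1 = esz l1 + esz l2.
Proof.
elim: l1 => [|a l1 IH]; first by rewrite esz_nil.
rewrite cat_cons !esz_cons; lia.
Qed.

Lemma esz_rev A {EA : Enc A} (l : seq A) : esz (rev l) = esz l.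
Proof.
elim: l => // a l IH; rewrite rev_cons -cats1 esz_cons.
generalize (esz_cat (rev l) [:: a]); rewrite esz_cons esz_nil IH; lia.
Qed.

Lemma size_esz A {EA : Enc A} (l : seq A) : size l <= esz l.
Proof. elim: l => //= a l IH; rewrite esz_cons; lia. Qed.

Lemma PS_size A B {EA : Enc A} {EB : Enc B} (f : A -> B) : PS f ->
  exists k, forall a, esz (f a) <= (esz a).+2 ^ k.
Proof. by move=> /PS_elim [c [k H]]; exists k => a; case: (H a). Qed.

Section Lifted.
Context {X A B C : Type} {EX : Enc X} {EA : Enc A} {EB : Enc B} {EC : Enc C}.

Lemma PS_fst (f : X -> A * B) : PS f -> PS (fun x => (f x).1).
Proof. exact: PS_comp PS_fst'. Qed.

Lemma PS_snd (f : X -> A * B) : PS f -> PS (fun x => (f x).2).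
Proof. exact: PS_comp PS_snd'. Qed.

Lemma PS_comp2 (h : A -> B -> C) (f : X -> A) (g : X -> B) :
  PS (fun z : A * B => h z.1 z.2) -> PS f -> PS g -> PS (fun x => h (f x) (g x)).
Proof. move=> Hh Hf Hg; exact (PS_comp Hh (PS_pair Hf Hg)). Qed.
End Lifted.

Section Lifted2.
Context {X A B C Y : Type} {EX : Enc X} {EA : Enc A} {EB : Enc B} {EC : Enc C} {EY : Enc Y}.

Lemma PS_comp3 (h : A -> B -> C -> Y) (f : X -> A) (g : X -> B) (k : X -> C) :
  PS (fun z : A * B * C => h z.1.1 z.1.2 z.2) -> PS f -> PS g -> PS k ->
  PS (fun x => h (f x) (g x) (k x)).
Proof.
move=> Hh Hf Hg Hk.
refine (PS_comp (g := fun z : A * B * C => h z.1.1 z.1.2 z.2) Hh (PS_pair (PS_pair Hf Hg) Hk)).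
Qed.

Lemma PS_negb (b : X -> bool) : PS b -> PS (fun x => ~~ b x).
Proof.
move=> H; refine (PS_eq (f := fun x => if b x then false else true) _ _).
  by move=> x; case: (b x).
exact (PS_if H (PS_const _) (PS_const _)).
Qed.

Lemma PS_andb (b c : X -> bool) : PS b -> PS c -> PS (fun x => b x && c x).
Proof. move=> H H'; exact (PS_if H H' (PS_const _)). Qed.

Lemma PS_orb (b c : X -> bool) : PS b -> PS c -> PS (fun x => b x || c x).
Proof. move=> H H'; exact (PS_if H (PS_const _) H'). Qed.

Lemma PS_eqb (b c : X -> bool) : PS b -> PS c -> PS (fun x => b x == c x).
Proof.
move=> H H'; refine (PS_eq (f := fun x => if b x then c x else ~~ c x) _ _).
  by move=> x; case: (b x); case: (c x).
exact (PS_if H H' (PS_negb H')).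
Qed.

End Lifted2.

Section Fold.
Context {X A B : Type} {EX : Enc X} {EA : Enc A} {EB : Enc B}.

(** The loop state holds the parameter, the accumulator and the unread suffix. The bound is required
    at each prefix because the final value does not control the earlier accumulators. *)
Lemma PS_foldl (f : X -> B -> A -> B) (b0 : X -> B) (l : X -> seq A) p :
  PS (fun z : X * B * A => f z.1.1 z.1.2 z.2) -> PS b0 -> PS l -> poly p ->
  (forall x l1 l2, l x = l1 ++ l2 -> esz (foldl (f x) (b0 x) l1) <= p (esz x)) ->
  PS (fun x => foldl (f x) (b0 x) (l x)).
Proof.
move=> Hf Hb Hl Pp Hp.
pose st : Type := (X * (B * seq A))%type.
pose test (s : st) := if s.2.2 is _ :: _ then true else false.
pose next (s : st) := if s.2.2 is a :: l' then (s.1, (f s.1 s.2.1 a, l')) else s.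
have [k Hk] := PS_size Hl.
enough (H : PS (fun x => (x, (foldl (f x) (b0 x) (l x), @nil A)))).
  exact (PS_fst (PS_snd H)).
refine (@PS_while _ _ _ _ test next (fun x => (x, (b0 x, l x))) _
  (fun m => m + (p m + m.+2 ^ k) + 2) _ _ _ _ _).
- exact (PS_match (g := fun _ _ _ => true) (PS_snd (PS_snd PS_id)) (PS_const _) (PS_const _)).
- refine (PS_match (g := fun (s : st) a l' => (s.1, (f s.1 s.2.1 a, l')))
    (PS_snd (PS_snd PS_id)) PS_id _).
  refine (PS_pair (PS_fst (PS_fst PS_id)) (PS_pair _ (PS_snd (PS_snd PS_id)))).
  exact (PS_comp3 Hf (PS_fst (PS_fst PS_id)) (PS_fst (PS_snd (PS_fst PS_id)))
    (PS_fst (PS_snd PS_id))).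
- exact (PS_pair PS_id (PS_pair Hb Hl)).
- by poly.
move=> x; split=> //.
have K l1 l2 : l x = l1 ++ l2 -> loop test next (esz x + (p (esz x) + (esz x).+2 ^ k) + 2)
    (x, (foldl (f x) (b0 x) l1, l2)) (x, (foldl (f x) (b0 x) (l x), [::])).
  elim: l2 l1 => [|a l2 IH] l1 E.
    have H1 := Hp x l1 _ E; move: E; rewrite cats0 => ->.
    by apply: loop_refl; rewrite !esz_pair /= esz_nil; have := expn_gt0 (esz x).+2 k; lia.
  apply: loop_step => //.
    have H1 := Hp x l1 _ E; have H2 := Hk x; rewrite !esz_pair /=.
    move: H2; rewrite E; generalize (esz_cat l1 (a :: l2)); generalize (esz_gt0 l1); lia.
  rewrite /next /= -(foldl_rcons (f x)); apply: IH.
  by rewrite cat_rcons.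
exact: (K [::]).
Qed.

End Fold.

Section Lists.
Context {X A B : Type} {EX : Enc X} {EA : Enc A} {EB : Enc B}.

Lemma PS_catrev (l1 l2 : X -> seq A) : PS l1 -> PS l2 -> PS (fun x => catrev (l1 x) (l2 x)).
Proof.
move=> H1 H2; have [k Hk] := PS_size H1; have [j Hj] := PS_size H2.
have E (s t : seq A) : foldl (fun acc a => a :: acc) t s = catrev s t.
  by elim: s t => //= a s IH t; rewrite IH.
refine (PS_eq (f := fun x => foldl (fun acc a => a :: acc) (l2 x) (l1 x)) _ _) => [x|]; first exact: E.
refine (PS_foldl (p := fun m => m.+2 ^ k + m.+2 ^ j) (f := fun _ acc a => a :: acc) _ H2 H1 _ _).
- exact (PS_cons (PS_snd PS_id) (PS_snd (PS_fst PS_id))).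
- by poly.
move=> x s t Es; rewrite E catrevE.
generalize (esz_cat (rev s) (l2 x)); generalize (esz_cat s t); rewrite -Es esz_rev.
have := Hk x; have := Hj x; generalize (esz_gt0 t); lia.
Qed.

Lemma PS_rev (l : X -> seq A) : PS l -> PS (fun x => rev (l x)).
Proof. by move=> H; exact (PS_catrev H (PS_const _)). Qed.

End Lists.

Section Lists2.
Context {X A B : Type} {EX : Enc X} {EA : Enc A} {EB : Enc B}.

Lemma PS_cat (l1 l2 : X -> seq A) : PS l1 -> PS l2 -> PS (fun x => l1 x ++ l2 x).
Proof.
move=> H1 H2; refine (PS_eq (f := fun x => catrev (rev (l1 x)) (l2 x)) _ _) => [x|].
  exact: catrev_rev.
exact (PS_catrev (PS_rev H1) H2).
Qed.

Lemma PS_foldr (f : X -> A -> B -> B) (b0 : X -> B) (l : X -> seq A) p :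
  PS (fun z : X * A * B => f z.1.1 z.1.2 z.2) -> PS b0 -> PS l -> poly p ->
  (forall x l1 l2, l x = l1 ++ l2 -> esz (foldr (f x) (b0 x) l2) <= p (esz x)) ->
  PS (fun x => foldr (f x) (b0 x) (l x)).
Proof.
move=> Hf Hb Hl Pp Hp.
refine (PS_eq (f := fun x => foldl (fun b a => f x a b) (b0 x) (rev (l x))) _ _) => [x|].
  by rewrite foldl_rev.
refine (PS_foldl (f := fun x b a => f x a b) (p := p) _ Hb (PS_rev Hl) Pp _).
  exact (PS_comp3 Hf (PS_fst (PS_fst PS_id)) (PS_snd PS_id) (PS_snd (PS_fst PS_id))).
move=> x l1 l2 E; rewrite -[l1]revK foldl_rev; apply: (Hp x (rev l2)).
by rewrite -rev_cat -E revK.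
Qed.

End Lists2.

Section Flat.
Context {X A B : Type} {EX : Enc X} {EA : Enc A} {EB : Enc B}.

Lemma PS_flatmap (f : X -> A -> seq B) (l : X -> seq A) :
  PS (fun z : X * A => f z.1 z.2) -> PS l -> PS (fun x => flatten (map (f x) (l x))).
Proof.
move=> Hf Hl; have [k Hk] := PS_size Hl; have [j Hj] := PS_size Hf.
have E x (s : seq A) : foldr (fun a acc => f x a ++ acc) [::] s = flatten (map (f x) s).
  by elim: s => //= a s ->.
refine (PS_eq (f := fun x => foldr (fun a acc => f x a ++ acc) [::] (l x)) _ _) => [x|].
  exact: E.
refine (PS_foldr (p := fun m => m.+2 ^ k * (m + m.+2 ^ k + 1).+2 ^ j + 1)
  (f := fun x a acc => f x a ++ acc) (b0 := fun _ => [::]) _ (PS_const _) Hl _ _).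
- refine (PS_cat _ (PS_snd PS_id)).
  exact (PS_comp2 (h := f) Hf (PS_fst (PS_fst PS_id)) (PS_snd (PS_fst PS_id))).
- by poly.
move=> x l1 l2 El; rewrite E.
have := Hk x; rewrite El => le.
have {le} : esz l2 <= (esz x).+2 ^ k by generalize (esz_cat l1 l2); generalize (esz_gt0 l1); lia.
(* [K] bounds the number of elements and [J] the size of the image of any one of them. *)
set K := (esz x).+2 ^ k; set J := (_.+2 ^ j) => le.
have {le} [le1 le2] : size l2 <= K /\ esz l2 <= K by generalize (size_esz l2); lia.
apply: (@leq_trans (size l2 * J + 1)); last by rewrite leq_add2r leq_mul2r le1 orbT.
elim: (l2) le2 {le1 El E} => [|a s IH] le2; first by rewrite esz_nil.
generalize (esz_cat (f x a) (flatten (map (f x) s))); rewrite /= mulSn.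
move: le2; rewrite esz_cons => le2.
have {}IH := IH _; have : esz (f x a) <= J.
  apply: leq_trans (Hj (x, a)) _; apply: leq_exp_mono; rewrite esz_pair /=; lia.
have := IH _; lia.
Qed.

Lemma PS_map (f : X -> A -> B) (l : X -> seq A) :
  PS (fun z : X * A => f z.1 z.2) -> PS l -> PS (fun x => map (f x) (l x)).
Proof.
move=> Hf Hl; refine (PS_eq (f := fun x => flatten (map (fun a => [:: f x a]) (l x))) _ _) => [x|].
  by elim: (l x) => //= a s ->.
refine (PS_flatmap (f := fun x a => [:: f x a]) _ Hl).
exact (PS_cons Hf (PS_const _)).
Qed.

End Flat.

Section Lists3.
Context {X A B : Type} {EX : Enc X} {EA : Enc A} {EB : Enc B}.

Lemma PS_filter (f : X -> A -> bool) (l : X -> seq A) :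
  PS (fun z : X * A => f z.1 z.2) -> PS l -> PS (fun x => filter (f x) (l x)).
Proof.
move=> Hf Hl.
refine (PS_eq (f := fun x => flatten (map (fun a => if f x a then [:: a] else [::]) (l x))) _ _) => [x|].
  by elim: (l x) => //= a s ->; case: (f x a).
refine (PS_flatmap (f := fun x a => if f x a then [:: a] else [::]) _ Hl).
exact (PS_if Hf (PS_cons (PS_snd PS_id) (PS_const _)) (PS_const _)).
Qed.

Lemma PS_nilp (l : X -> seq A) : PS l -> PS (fun x => nilp (l x)).
Proof.
move=> Hl; refine (PS_eq (f := fun x => if l x is a :: l' then false else true) _ _) => [x|].
  by case: (l x).
exact (PS_match (g := fun _ _ _ => false) Hl (PS_const _) (PS_const _)).
Qed.

Lemma PS_has (f : X -> A -> bool) (l : X -> seq A) :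
  PS (fun z : X * A => f z.1 z.2) -> PS l -> PS (fun x => has (f x) (l x)).
Proof.
move=> Hf Hl; refine (PS_eq (f := fun x => foldl (fun b a => b || f x a) false (l x)) _ _) => [x|].
  rewrite -[RHS]orFb; elim: (l x) (false) => [|a s IH] b /=; first by rewrite orbF.
  by rewrite IH orbA.
refine (PS_foldl (f := fun x b a => b || f x a) (b0 := fun _ => false) (p := fun=> 3) _ (PS_const _) Hl _ _).
- refine (PS_orb (PS_snd (PS_fst PS_id)) _).
  exact (PS_comp2 (h := f) Hf (PS_fst (PS_fst PS_id)) (PS_snd PS_id)).
- by poly.
by move=> *; exact: esz_bool.
Qed.

Lemma PS_size_seq (l : X -> seq A) : PS l -> PS (fun x => size (l x)).
Proof.
move=> Hl; refine (PS_eq (f := fun x => size (map (fun _ => tt) (l x))) _ _) => [x|].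
  exact: size_map.
refine (PS_comp (g := @size unit) _ _); last first.
  exact (PS_map (f := fun _ _ => tt) (PS_const _) Hl).
by refine (PS_recode _); elim=> // -[] s IH; congr (Node Leaf).
Qed.

Lemma PS_nseq_tt (n : X -> nat) : PS n -> PS (fun x => nseq (n x) tt).
Proof.
refine (PS_comp (g := fun n => nseq n tt) _); refine (PS_recode _).
by elim=> // n' IH; congr (Node Leaf).
Qed.

End Lists3.

Section Lists4.
Context {X A B : Type} {EX : Enc X} {EA : Enc A} {EB : Enc B}.

Lemma PS_all (f : X -> A -> bool) (l : X -> seq A) :
  PS (fun z : X * A => f z.1 z.2) -> PS l -> PS (fun x => all (f x) (l x)).
Proof.
move=> Hf Hl; refine (PS_eq (f := fun x => ~~ has (fun a => ~~ f x a) (l x)) _ _) => [x|].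
  by rewrite has_predC negbK.
exact (PS_negb (PS_has (f := fun x a => ~~ f x a) (PS_negb Hf) Hl)).
Qed.

Lemma PS_succn (n : X -> nat) : PS n -> PS (fun x => (n x).+1).
Proof.
move=> Hn; refine (PS_eq (f := fun x => size (tt :: nseq (n x) tt)) _ _) => [x|].
  by rewrite /= size_nseq.
exact (PS_size_seq (PS_cons (PS_const _) (PS_nseq_tt Hn))).
Qed.

Lemma PS_behead (l : X -> seq A) : PS l -> PS (fun x => behead (l x)).
Proof.
move=> Hl; refine (PS_eq (f := fun x => if l x is a :: l' then l' else [::]) _ _) => [x|].
  by case: (l x).
exact (PS_match (g := fun _ _ l' => l') Hl (PS_const _) (PS_snd (PS_snd PS_id))).
Qed.

Lemma PS_head (d : X -> A) (l : X -> seq A) : PS d -> PS l -> PS (fun x => head (d x) (l x)).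
Proof.
move=> Hd Hl; refine (PS_eq (f := fun x => if l x is a :: l' then a else d x) _ _) => [x|].
  by case: (l x).
exact (PS_match (g := fun _ a _ => a) Hl Hd (PS_fst (PS_snd PS_id))).
Qed.

Lemma PS_iter (n : X -> nat) (f : X -> A -> A) (a0 : X -> A) p :
  PS n -> PS (fun z : X * A => f z.1 z.2) -> PS a0 -> poly p ->
  (forall x i, i <= n x -> esz (iter i (f x) (a0 x)) <= p (esz x)) ->
  PS (fun x => iter (n x) (f x) (a0 x)).
Proof.
move=> Hn Hf Ha Pp Hp.
have E x i : foldl (fun a (_ : unit) => f x a) (a0 x) (nseq i tt) = iter i (f x) (a0 x).
  by elim: i (a0 x) => // i IH a; rewrite iterSr -IH.
refine (PS_eq (f := fun x => foldl (fun a (_ : unit) => f x a) (a0 x) (nseq (n x) tt)) _ _) => [x|].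
  exact: E.
refine (PS_foldl (f := fun x a (_ : unit) => f x a) _ Ha (PS_nseq_tt Hn) Pp _).
  exact (PS_comp2 (h := f) Hf (PS_fst (PS_fst PS_id)) (PS_snd (PS_fst PS_id))).
move=> x l1 l2 El.
have -> : l1 = nseq (size l1) tt by elim: (l1) => //= -[] s {1}->.
rewrite E; apply: Hp; move/(congr1 size): El; rewrite size_nseq size_cat; lia.
Qed.

End Lists4.

(** * Arithmetic on unary numbers *)

Section Nat.
Context {X A : Type} {EX : Enc X} {EA : Enc A}.

Lemma PS_addn (m n : X -> nat) : PS m -> PS n -> PS (fun x => m x + n x).
Proof.
move=> Hm Hn; refine (PS_eq (f := fun x => size (nseq (m x) tt ++ nseq (n x) tt)) _ _) => [x|].
  by rewrite size_cat !size_nseq.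
exact (PS_size_seq (PS_cat (PS_nseq_tt Hm) (PS_nseq_tt Hn))).
Qed.

Lemma PS_muln (m n : X -> nat) : PS m -> PS n -> PS (fun x => m x * n x).
Proof.
move=> Hm Hn.
refine (PS_eq (f := fun x => size (flatten (map (fun _ : unit => nseq (n x) tt) (nseq (m x) tt)))) _ _) => [x|].
  by elim: (m x) => //= k IH; rewrite size_cat size_nseq IH mulSn.
refine (PS_size_seq (PS_flatmap (f := fun x (_ : unit) => nseq (n x) tt) _ (PS_nseq_tt Hm))).
exact (PS_comp (PS_nseq_tt Hn) (PS_fst PS_id)).
Qed.

Lemma PS_drop (n : X -> nat) (l : X -> seq A) : PS n -> PS l -> PS (fun x => drop (n x) (l x)).
Proof.
move=> Hn Hl; have [k Hk] := PS_size Hl.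
have E (s : seq A) i : iter i behead s = drop i s.
  by elim: i s => [|i IH] s; rewrite ?drop0 // iterSr IH; case: s.
refine (PS_eq (f := fun x => iter (n x) behead (l x)) _ _) => [x|]; first exact: E.
refine (PS_iter (f := fun _ => behead) (p := fun m => m.+2 ^ k) Hn (PS_behead (PS_snd PS_id)) Hl _ _).
  by poly.
move=> x i _; rewrite E; apply: leq_trans (Hk x).
generalize (esz_cat (take i (l x)) (drop i (l x))); rewrite cat_take_drop.
generalize (esz_gt0 (take i (l x))); lia.
Qed.

End Nat.

Section Nat2.
Context {X A : Type} {EX : Enc X} {EA : Enc A}.

Lemma PS_subn (m n : X -> nat) : PS m -> PS n -> PS (fun x => m x - n x).
Proof.
move=> Hm Hn; refine (PS_eq (f := fun x => size (drop (n x) (nseq (m x) tt))) _ _) => [x|].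
  by rewrite size_drop size_nseq.
exact (PS_size_seq (PS_drop Hn (PS_nseq_tt Hm))).
Qed.

Lemma PS_nth (d : X -> A) (l : X -> seq A) (n : X -> nat) : PS d -> PS l -> PS n ->
  PS (fun x => nth (d x) (l x) (n x)).
Proof.
move=> Hd Hl Hn; refine (PS_eq (f := fun x => head (d x) (drop (n x) (l x))) _ _) => [x|].
  by rewrite -nth0 nth_drop addn0.
exact (PS_head Hd (PS_drop Hn Hl)).
Qed.

End Nat2.

Lemma esz_iota m i : esz (iota m i) <= i * ((m + i) * 2 + 2) + 1.
Proof.
elim: i m => [|i IH] m; first by rewrite esz_nil.
generalize (IH m.+1); rewrite addSnnS [iota _ i.+1]/= esz_cons esz_nat mulSn; lia.
Qed.

Section Nat3.
Context {X A : Type} {EX : Enc X} {EA : Enc A}.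

Lemma PS_predn (m : X -> nat) : PS m -> PS (fun x => (m x).-1).
Proof.
move=> Hm; refine (PS_eq (f := fun x => m x - 1) _ _) => [x|]; first by rewrite subn1.
exact (PS_subn Hm (PS_const _)).
Qed.

Lemma PS_leq (m n : X -> nat) : PS m -> PS n -> PS (fun x => m x <= n x).
Proof.
move=> Hm Hn; refine (PS_eq (f := fun x => nilp (nseq (m x - n x) tt)) _ _) => [x|].
  by rewrite /nilp size_nseq.
exact (PS_nilp (PS_nseq_tt (PS_subn Hm Hn))).
Qed.

Lemma PS_eqn (m n : X -> nat) : PS m -> PS n -> PS (fun x => m x == n x).
Proof.
move=> Hm Hn; refine (PS_eq (f := fun x => (m x <= n x) && (n x <= m x)) _ _) => [x|].
  by rewrite eqn_leq.
exact (PS_andb (PS_leq Hm Hn) (PS_leq Hn Hm)).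
Qed.

Lemma PS_iota (n : X -> nat) : PS n -> PS (fun x => iota 0 (n x)).
Proof.
move=> Hn; have [k Hk] := PS_size Hn.
have E i : iter i (fun s : seq nat => rcons s (size s)) [::] = iota 0 i.
  by elim: i => // i IH; rewrite iterS IH size_iota -[in RHS]addn1 iotaD cats1.
refine (PS_eq (f := fun x => iter (n x) (fun s => rcons s (size s)) [::]) _ _) => [x|]; first exact: E.
refine (PS_iter (f := fun _ s => rcons s (size s)) (a0 := fun _ => [::])
   (p := fun m => m.+2 ^ k * (m.+2 ^ k * 2 + 2) + 1) Hn _ (PS_const _) _ _).
- refine (PS_eq (f := fun z : X * seq nat => z.2 ++ [:: size z.2]) _ _) => [x|].
    by rewrite cats1.
  exact (PS_cat (PS_snd PS_id) (PS_cons (PS_size_seq (PS_snd PS_id)) (PS_const _))).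
- by poly.
move=> x i le; rewrite E.
have leK : i <= (esz x).+2 ^ k by have := Hk x; rewrite esz_nat; lia.
apply: leq_trans (esz_iota 0 i) _; rewrite add0n leq_add2r leq_mul //; lia.
Qed.

End Nat3.

Section Find.
Context {X A B : Type} {EX : Enc X} {EA : Enc A} {EB : Enc B}.

Lemma PS_find (f : X -> A -> bool) (l : X -> seq A) :
  PS (fun z : X * A => f z.1 z.2) -> PS l -> PS (fun x => find (f x) (l x)).
Proof.
move=> Hf Hl; have [k Hk] := PS_size Hl.
have E x (s : seq A) : foldr (fun a n => if f x a then 0 else n.+1) 0 s = find (f x) s.
  by elim: s => //= a s ->.
refine (PS_eq (f := fun x => foldr (fun a n => if f x a then 0 else n.+1) 0 (l x)) _ _) => [x|].
  exact: E.
refine (PS_foldr (f := fun x a n => if f x a then 0 else n.+1) (b0 := fun _ => 0)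
  (p := fun m => m.+2 ^ k * 2 + 1) _ (PS_const _) Hl _ _).
- refine (PS_if _ (PS_const _) (PS_succn (PS_snd PS_id))).
  exact (PS_comp2 (h := f) Hf (PS_fst (PS_fst PS_id)) (PS_snd (PS_fst PS_id))).
- by poly.
move=> x l1 l2 El; rewrite E esz_nat.
have := find_size (f x) l2; have := Hk x; rewrite El; generalize (size_esz (l1 ++ l2)).
rewrite size_cat; lia.
Qed.

End Find.

(** * Depth-first search *)

Section Win.
Variables (A : Type) (kids : A -> seq A) (fin val mode : A -> bool).

(** Where the depth runs out, [val] decides. For Quoridor it says that White has already won, so an
    unfinished game counts as not won. *)
Fixpoint win (k : nat) (x : A) : bool :=
  if fin x || nilp (kids x) then val x
  else if k is k'.+1 then (if mode x then has (win k') (kids x) else all (win k') (kids x))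
  else val x.

End Win.

Section Search.
Context {A : Type} {EA : Enc A}.
Variables (kids : A -> seq A) (fin val mode : A -> bool) (b : A -> nat) (q : nat).
Hypotheses (Pkids : PS kids) (Pfin : PS fin) (Pval : PS val) (Pmode : PS mode).
(** The three hypotheses on the potential [b] keep all descendants polynomial in the size of the
    root. *)
Hypothesis bq : forall x, b x <= (esz x).+2 ^ q.
Hypothesis esz_b : forall x, esz x <= b x.
Hypothesis b_kids : forall x, all (fun y => b y <= b x) (kids x).

(* The last value returned, the node to be evaluated next (if any), and a stack
   of frames (mode, depth, unexplored siblings). *)
Let st : Type := (bool * (seq (nat * A) * seq (bool * (nat * seq A))))%type.

Let test (s : st) : bool := ~~ (nilp s.2.1 && nilp s.2.2).

(** A returned value equal to the mode settles the node: [true] a disjunction, [false] a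
    conjunction. When no sibling is left, the last value is that of the node. *)
Let next_frame (s : st) (fr : bool * (nat * seq A)) (frs : seq (bool * (nat * seq A))) : st :=
  if fr.2.2 is y :: ys then
    if s.1 == fr.1 then (s.1, ([::], frs))
    else (s.1, ([:: (fr.2.1, y)], (fr.1, (fr.2.1, ys)) :: frs))
  else (s.1, ([::], frs)).

Let next_eval (s : st) (kx : nat * A) : st :=
  if fin kx.2 || (kx.1 == 0) then (val kx.2, ([::], s.2.2))
  else if kids kx.2 is y :: ys then
    (s.1, ([:: (kx.1.-1, y)], (mode kx.2, (kx.1.-1, ys)) :: s.2.2))
  else (val kx.2, ([::], s.2.2)).

Let next (s : st) : st :=
  if s.2.1 is kx :: _ then next_eval s kx
  else if s.2.2 is fr :: frs then next_frame s fr frs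
  else s.

Lemma PS_next_frame : PS (fun z : st * ((bool * (nat * seq A)) * seq (bool * (nat * seq A))) =>
   next_frame z.1 z.2.1 z.2.2).
Proof.
rewrite /next_frame.
refine (PS_match (l := fun z : st * ((bool * (nat * seq A)) * seq (bool * (nat * seq A))) => z.2.1.2.2)
 (f := fun z => (z.1.1, ([::], z.2.2)))
 (g := fun z y ys => if z.1.1 == z.2.1.1 then (z.1.1, ([::], z.2.2)) else
     (z.1.1, ([:: (z.2.1.2.1, y)], (z.2.1.1, (z.2.1.2.1, ys)) :: z.2.2))) _ _ _).
- exact (PS_snd (PS_snd (PS_fst (PS_snd PS_id)))).
- exact (PS_pair (PS_fst (PS_fst PS_id)) (PS_pair (PS_const _) (PS_snd (PS_snd PS_id)))).
- refine (PS_if _ _ _).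
  + exact (PS_eqb (PS_fst (PS_fst (PS_fst PS_id))) (PS_fst (PS_fst (PS_snd (PS_fst PS_id))))).
  + exact (PS_pair (PS_fst (PS_fst (PS_fst PS_id)))
      (PS_pair (PS_const _) (PS_snd (PS_snd (PS_fst PS_id))))).
  + refine (PS_pair (PS_fst (PS_fst (PS_fst PS_id)))
      (PS_pair (PS_cons (PS_pair _ (PS_fst (PS_snd PS_id))) (PS_const _))
        (PS_cons (PS_pair (PS_fst (PS_fst (PS_snd (PS_fst PS_id))))
            (PS_pair _ (PS_snd (PS_snd PS_id))))
          (PS_snd (PS_snd (PS_fst PS_id))))));
    exact (PS_fst (PS_snd (PS_fst (PS_snd (PS_fst PS_id))))).
Qed.

Lemma PS_next_eval : PS (fun z : st * (nat * A) => next_eval z.1 z.2).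
Proof.
rewrite /next_eval.
have Pv : PS (fun z : st * (nat * A) => (val z.2.2, (@nil (nat * A), z.1.2.2))).
  exact (PS_pair (PS_comp Pval (PS_snd (PS_snd PS_id)))
     (PS_pair (PS_const _) (PS_snd (PS_snd (PS_fst PS_id))))).
refine (PS_if _ Pv _).
  exact (PS_orb (PS_comp Pfin (PS_snd (PS_snd PS_id)))
     (PS_eqn (PS_fst (PS_snd PS_id)) (PS_const _))).
refine (PS_match (l := fun z : st * (nat * A) => kids z.2.2)
 (f := fun z : st * (nat * A) => (val z.2.2, (@nil (nat * A), z.1.2.2)))
 (g := fun z y ys => (z.1.1, ([:: (z.2.1.-1, y)], (mode z.2.2, (z.2.1.-1, ys)) :: z.1.2.2)))
  _ Pv _).
  exact (PS_comp Pkids (PS_snd (PS_snd PS_id))).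
have Pk : PS (fun z : st * (nat * A) * (A * seq A) => z.1.2.1.-1).
  exact (PS_predn (PS_fst (PS_snd (PS_fst PS_id)))).
exact (PS_pair (PS_fst (PS_fst (PS_fst PS_id))) (PS_pair
   (PS_cons (PS_pair Pk (PS_fst (PS_snd PS_id))) (PS_const _))
   (PS_cons (PS_pair (PS_comp Pmode (PS_snd (PS_snd (PS_fst PS_id)))) (PS_pair Pk (PS_snd (PS_snd PS_id))))
      (PS_snd (PS_snd (PS_fst (PS_fst PS_id))))))).
Qed.

Lemma PS_next : PS next.
Proof.
refine (PS_match (l := fun s : st => s.2.1) (g := fun (s : st) kx _ => next_eval s kx)
   (f := fun s : st => if s.2.2 is fr :: frs then next_frame s fr frs else s) _ _ _).
- exact (PS_fst (PS_snd PS_id)).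
- exact (PS_match (l := fun s : st => s.2.2) (g := next_frame) (PS_snd (PS_snd PS_id)) PS_id PS_next_frame).
- exact (PS_comp PS_next_eval (PS_pair (PS_fst PS_id) (PS_fst (PS_snd PS_id)))).
Qed.

Lemma PS_test : PS test.
Proof.
exact (PS_negb (PS_andb (PS_nilp (PS_fst (PS_snd PS_id))) (PS_nilp (PS_snd (PS_snd PS_id))))).
Qed.

Notation win := (win kids fin val mode).

(** [T] is a budget for the frame stack. Each of the [k] levels still to come may add one frame,
    made of a mode, a depth of at most [K], and siblings of size at most [B.+2 ^ r]; the 10 covers
    the mode and the constructors. The surplus over [T] is for the current node and value. *)
Lemma loop_win r K B T : (forall x, esz (kids x) <= (esz x).+2 ^ r) ->
  forall k x v s, k <= K -> b x <= B -> esz s + k * (2 * K + B.+2 ^ r + 10) <= T ->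
  loop test next (T + 2 * K + B + 20) (v, ([:: (k, x)], s)) (win k x, ([::], s)).
Proof.
move=> Hr; set G := _ + _ + 10; set M := T + _ + _ + _.
have szE (v : bool) k x s : k <= K -> b x <= B -> esz s <= T -> esz ((v, ([:: (k, x)], s)) : st) <= M.
  move=> kK xB sT; rewrite !esz_pair /= esz_cons esz_pair esz_nil esz_nat /M /=.
  have := esz_bool v; have := esz_b x; lia.
have szR (v : bool) s : esz s <= T -> esz ((v, ([::], s)) : st) <= M.
  by move=> sT; rewrite !esz_pair /= esz_nil /M; have := esz_bool v; lia.
elim=> [|k IH] x v s kK xB sT.
  apply: loop_step => //; first by apply: szE => //; lia.
  rewrite /next /= /next_eval /= orbT !if_same; apply: loop_refl; apply: szR; lia.
have sT' : esz s <= T by lia.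
apply: loop_step => //; first exact: szE.
rewrite /next /= /next_eval /=; rewrite orbF; case fx: (fin x) => /=.
  by apply: loop_refl; apply: szR.
case Ek: (kids x) => [|y ys] /=; first by apply: loop_refl; apply: szR.
have kB : all (fun y => b y <= B) (y :: ys).
  by rewrite -Ek; apply: sub_all (b_kids x) => z /leq_trans; apply.
have kG : esz (y :: ys) <= B.+2 ^ r.
  by rewrite -Ek; apply: leq_trans (Hr x) _; apply: leq_exp_mono; apply: leq_trans (esz_b x) xB.
have -> : (if mode x then win k y || has (win k) ys else win k y && all (win k) ys) =
   (if mode x then has (win k) (y :: ys) else all (win k) (y :: ys)) by [].
(* Inner induction on the siblings: the value of [y] settles the node, or the search passes to
   [z]. *)
elim: ys y v kB kG {Ek} => [|z ys IHys] y v kB kG.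
  apply: (@loop_trans _ _ _ _ _ _ (win k y, ([::], (mode x, (k, [::])) :: s))).
    apply: IH; first exact: ltnW; first by case/andP: kB.
    move: kG; rewrite !esz_cons !esz_pair /= esz_nil esz_nat /=; have := esz_bool (mode x); rewrite /G; lia.
  apply: loop_step => //.
    apply: szR; move: kG; rewrite !esz_cons !esz_pair /= esz_nil esz_nat /=; have := esz_bool (mode x); rewrite /G; lia.
  rewrite /next /= /next_frame /= orbF andbT if_same; apply: loop_refl; exact: szR.
have fT l : esz l < esz (y :: z :: ys) -> esz ((mode x, (k, l)) :: s) + k * G <= T.
  rewrite !esz_cons !esz_pair /= esz_nat; have := esz_bool (mode x); move: kG; rewrite !esz_cons /G; lia.
have fT0 : esz ((mode x, (k, z :: ys)) :: s) + k * G <= T by apply: fT; rewrite (esz_cons y); lia.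
case/andP: kB => yB kB.
apply: (@loop_trans _ _ _ _ _ _ (win k y, ([::], (mode x, (k, z :: ys)) :: s))).
  by apply: IH => //; exact: ltnW.
apply: loop_step => //; first by apply: szR; lia.
rewrite /next /= /next_frame /=.
case: eqP => [Ev|Ev].
  rewrite (_ : (if mode x then _ else _) = win k y); first by apply: loop_refl; exact: szR.
  by move: Ev; case: (mode x) => ->.
rewrite (_ : (if mode x then _ else _) = (if mode x then has (win k) (z :: ys) else all (win k) (z :: ys))); last first.
  by move: Ev; case: (mode x); case: (win k y).
apply: IHys => //; move: kG; rewrite !esz_cons; lia.
Qed.

Lemma PS_win : PS (fun z : nat * A => win z.1 z.2).
Proof.
have [r Hr] := PS_size Pkids.
enough (H : PS (fun z : nat * A => ((win z.1 z.2, ([::], [::])) : st))) by exact (PS_fst H).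
(* The initial [false] is a placeholder: a leaf overwrites it before any frame reads it. Size and
   depth of the root are at most [m], its potential at most [m.+2 ^ q]. *)
refine (@PS_while st (nat * A) _ _ test next (fun z => (false, ([:: z], [::]))) _
  (fun m => (1 + m * (2 * m + (m.+2 ^ q).+2 ^ r + 10)) + 2 * m + m.+2 ^ q + 20)
   PS_test PS_next _ _ _).
- exact (PS_pair (PS_const _) (PS_pair (PS_cons PS_id (PS_const _)) (PS_const _))).
- by poly.
move=> [k x]; split=> //=.
set m := esz (k, x).
have [km xm] : k <= m /\ esz x <= m by rewrite /m esz_pair /= esz_nat; lia.
have bm : b x <= m.+2 ^ q by apply: leq_trans (bq x) _; apply: leq_exp_mono.
apply: loop_win => //.
by rewrite esz_nil leq_add2l leq_mul.
Qed.

End Search.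

(** * Quoridor on natural numbers *)

Lemma PS_unary X {EX : Enc X} (n : X -> nat) : PS n -> PS (fun x => unary (n x)).
Proof.
move=> Hn; refine (PS_eq (f := fun x => map (fun _ => true) (nseq (n x) tt) ++ [:: false]) _ _) => [x|].
  by rewrite /unary -cats1; congr (_ ++ _); elim: (n x) => //= k ->.
exact (PS_cat (PS_map (f := fun _ _ => true) (PS_const _) (PS_nseq_tt Hn)) (PS_const _)).
Qed.

Create HintDb ps.

Ltac ps_named :=
  match goal with
  | |- PS (fun x => ?h (@?a x) (@?b x) (@?c x)) =>
      refine (PS_comp3 (h := h) (f := a) (g := b) (k := c) _ _ _ _); [solve [auto with ps] | ..]
  | |- PS (fun x => ?h (@?a x) (@?b x)) =>
      refine (PS_comp2 (h := h) (f := a) (g := b) _ _ _); [solve [auto with ps] | ..]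
  | |- PS (fun x => ?h (@?a x)) =>
      refine (PS_comp (g := h) (f := a) _ _); [solve [auto with ps] | ..]
  end.

(** Second-order patterns extract the functions under the binder, so that each closure rule is
    applied to explicit arguments. Defined operations go through [ps_named] and the hints in
    [ps]. *)
Ltac ps1 :=
  cbv beta;
  lazymatch goal with
  | |- PS (fun x => x) => exact PS_id
  | |- PS (fun _ => ?c) => exact (PS_const c)
  | |- PS (fun x => fst (@?f x)) => refine (PS_fst (f := f) _)
  | |- PS (fun x => snd (@?f x)) => refine (PS_snd (f := f) _)
  | |- PS (fun x => (@?f x, @?g x)) => refine (PS_pair (f := f) (g := g) _ _)
  | |- PS (fun x => (@?f x) && (@?g x)) => refine (PS_andb (b := f) (c := g) _ _)
  | |- PS (fun x => (@?f x) || (@?g x)) => refine (PS_orb (b := f) (c := g) _ _)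
  | |- PS (fun x => ~~ (@?f x)) => refine (PS_negb (b := f) _)
  | |- PS (fun x => @?f x == @?g x) =>
      first [ refine (PS_eqn (m := f) (n := g) _ _) | refine (PS_eqb (b := f) (c := g) _ _) ]
  | |- PS (fun x => @?f x <= @?g x) => refine (PS_leq (m := f) (n := g) _ _)
  | |- PS (fun x => @?f x + @?g x) => refine (PS_addn (m := f) (n := g) _ _)
  | |- PS (fun x => @?f x * @?g x) => refine (PS_muln (m := f) (n := g) _ _)
  | |- PS (fun x => (@?f x).+1) => refine (PS_succn (n := f) _)
  | |- PS (fun x => (@?f x).-1) => refine (PS_predn (m := f) _)
  | |- PS (fun x => has (@?p x) (@?l x)) => refine (PS_has (f := p) (l := l) _ _)
  | |- PS (fun x => all (@?p x) (@?l x)) => refine (PS_all (f := p) (l := l) _ _)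
  | |- PS (fun x => filter (@?p x) (@?l x)) => refine (PS_filter (f := p) (l := l) _ _)
  | |- PS (fun x => find (@?p x) (@?l x)) => refine (PS_find (f := p) (l := l) _ _)
  | |- PS (fun x => flatten (map (@?p x) (@?l x))) => refine (PS_flatmap (f := p) (l := l) _ _)
  | |- PS (fun x => map (@?p x) (@?l x)) => refine (PS_map (f := p) (l := l) _ _)
  | |- PS (fun x => (@?p x) ++ (@?l x)) => refine (PS_cat (l1 := p) (l2 := l) _ _)
  | |- PS (fun x => (@?p x) :: (@?l x)) => refine (PS_cons (f := p) (g := l) _ _)
  | |- PS (fun x => nth (@?d x) (@?l x) (@?n x)) => refine (PS_nth (d := d) (l := l) (n := n) _ _ _)
  | |- PS (fun x => head (@?d x) (@?l x)) => refine (PS_head (d := d) (l := l) _ _)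
  | |- PS (fun x => behead (@?l x)) => refine (PS_behead (l := l) _)
  | |- PS (fun x => drop (@?n x) (@?l x)) => refine (PS_drop (n := n) (l := l) _ _)
  | |- PS (fun x => size (@?l x)) => refine (PS_size_seq (l := l) _)
  | |- PS (fun x => iota 0 (@?n x)) => refine (PS_iota (n := n) _)
  | |- PS (fun x => unary (@?n x)) => refine (PS_unary (n := n) _)
  | _ => first [ps_named | refine (PS_if _ _ _)]
  end.

Ltac ps := repeat ps1.

Notation nsquare := (nat * nat)%type.
Notation nwall := (bool * (nat * nat))%type.
(* board size, white and black pawns; walls, supplies, whether White is to move *)
Notation npos := ((nat * (nsquare * nsquare)) * (seq nwall * ((nat * nat) * bool)))%type.

Definition eqsq (s t : nsquare) := (s.1 == t.1) && (s.2 == t.2).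
Definition eqw (w v : nwall) := (w.1 == v.1) && eqsq w.2 v.2.

Definition n_adjacent (s t : nsquare) : bool :=
  ((s.1 == t.1) && consecutive s.2 t.2) || ((s.2 == t.2) && consecutive s.1 t.1).
Definition n_around (w : nwall) (s : nsquare) : bool :=
  ((s.1 == w.2.1) || (s.1 == w.2.1.+1)) && ((s.2 == w.2.2) || (s.2 == w.2.2.+1)).
Definition n_separates (w : nwall) (s t : nsquare) : bool :=
  [&& n_around w s, n_around w t & if w.1 then s.2 != t.2 else s.1 != t.1].
Definition n_open (W : seq nwall) (s t : nsquare) : bool :=
  n_adjacent s t && all (fun w => ~~ n_separates w s t) W.
Definition n_conflict (w v : nwall) : bool :=
  eqsq w.2 v.2 ||
  ((w.1 == v.1) &&
   (if w.1 then (w.2.2 == v.2.2) && consecutive w.2.1 v.2.1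
    else (w.2.1 == v.2.1) && consecutive w.2.2 v.2.2)).
Definition n_goal (n : nat) (c : bool) (s : nsquare) : bool :=
  if c then s.2 == n.-1 else s.2 == 0.
Definition n_squares (n : nat) : seq nsquare :=
  flatten [seq [seq (i, j) | j <- iota 0 n] | i <- iota 0 n].
Definition n_walls (n : nat) : seq nwall :=
  [seq (true, s) | s <- n_squares n.-1] ++ [seq (false, s) | s <- n_squares n.-1].
Definition n_grow (n : nat) (W : seq nwall) (R : seq nsquare) : seq nsquare :=
  [seq t <- n_squares n | has (fun u => eqsq u t || n_open W u t) R].
(** A path without repetitions visits at most [n * n] squares, so this many rounds reach
    everything. *)
Definition n_reach (n : nat) (W : seq nwall) (s : nsquare) : seq nsquare :=
  iter (n * n) (n_grow n W) [:: s].
(** Board size and walls are paired here because [ps_named] handles at most three arguments. *)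
Definition n_path (nW : nat * seq nwall) (c : bool) (s : nsquare) : bool :=
  has (fun t => n_goal nW.1 c t) (n_reach nW.1 nW.2 s).
Definition n_behind (s o t : nsquare) : bool :=
  (s.1 + t.1 == o.1 + o.1) && (s.2 + t.2 == o.2 + o.2).
Definition n_beside (s o t : nsquare) : bool :=
  [&& n_adjacent o t, s.1 != t.1 & s.2 != t.2].
Definition n_can_move (nW : nat * seq nwall) (so : nsquare * nsquare) (t : nsquare) : bool :=
  [|| n_open nW.2 so.1 t && ~~ eqsq t so.2,
      [&& n_open nW.2 so.1 so.2, n_behind so.1 so.2 t & n_open nW.2 so.2 t] |
      [&& n_open nW.2 so.1 so.2,
          ~~ has (fun u => n_behind so.1 so.2 u && n_open nW.2 so.2 u) (n_squares nW.1),
          n_beside so.1 so.2 t & n_open nW.2 so.2 t]].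
Definition n_can_place (p : npos) (w : nwall) : bool :=
  [&& 0 < (if p.2.2.2 then p.2.2.1.1 else p.2.2.1.2),
      all (fun v => ~~ n_conflict w v) p.2.1,
      n_path (p.1.1, w :: p.2.1) true p.1.2.1 &
      n_path (p.1.1, w :: p.2.1) false p.1.2.2].
Definition n_pawn_moves (p : npos) : seq nsquare :=
  [seq t <- n_squares p.1.1 | n_can_move (p.1.1, p.2.1)
     (if p.2.2.2 then p.1.2 else (p.1.2.2, p.1.2.1)) t].
Definition n_move (p : npos) (t : nsquare) : npos :=
  if p.2.2.2 then ((p.1.1, (t, p.1.2.2)), (p.2.1, (p.2.2.1, false)))
  else ((p.1.1, (p.1.2.1, t)), (p.2.1, (p.2.2.1, true))).
Definition n_place (p : npos) (w : nwall) : npos :=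
  if p.2.2.2 then (p.1, (w :: p.2.1, ((p.2.2.1.1.-1, p.2.2.1.2), false)))
  else (p.1, (w :: p.2.1, ((p.2.2.1.1, p.2.2.1.2.-1), true))).
Definition n_kids (p : npos) : seq npos :=
  [seq n_move p t | t <- n_pawn_moves p] ++
  [seq n_place p w | w <- [seq w <- n_walls p.1.1 | n_can_place p w]].
Definition n_won (p : npos) : bool := n_goal p.1.1 true p.1.2.1.
Definition n_over (p : npos) : bool := n_won p || n_goal p.1.1 false p.1.2.2.
Definition n_turn (p : npos) : bool := p.2.2.2.
(** Numbers being unary trees, [PS_depth] also shows that the depth is polynomial in the size of the
    position. *)
Definition n_depth (p : npos) : nat :=
  p.1.1 * p.1.1 * (p.1.1 * p.1.1) * 2 * (p.2.2.1.1 + p.2.2.1.2).+1.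

Lemma PS_consecutive : PS (fun z : nat * nat => consecutive z.1 z.2).
Proof. rewrite /consecutive; ps. Qed.
#[local] Hint Resolve PS_consecutive : ps.
Lemma PS_eqsq : PS (fun z : nsquare * nsquare => eqsq z.1 z.2).
Proof. rewrite /eqsq; ps. Qed.
#[local] Hint Resolve PS_eqsq : ps.
Lemma PS_eqw : PS (fun z : nwall * nwall => eqw z.1 z.2).
Proof. rewrite /eqw; ps. Qed.
#[local] Hint Resolve PS_eqw : ps.
Lemma PS_adjacent : PS (fun z : nsquare * nsquare => n_adjacent z.1 z.2).
Proof. rewrite /n_adjacent; ps. Qed.
#[local] Hint Resolve PS_adjacent : ps.
Lemma PS_around : PS (fun z : nwall * nsquare => n_around z.1 z.2).
Proof. rewrite /n_around; ps. Qed.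
#[local] Hint Resolve PS_around : ps.
Lemma PS_separates : PS (fun z : nwall * nsquare * nsquare => n_separates z.1.1 z.1.2 z.2).
Proof. rewrite /n_separates; ps. Qed.
#[local] Hint Resolve PS_separates : ps.
Lemma PS_open : PS (fun z : seq nwall * nsquare * nsquare => n_open z.1.1 z.1.2 z.2).
Proof. rewrite /n_open; ps. Qed.
#[local] Hint Resolve PS_open : ps.
Lemma PS_conflict : PS (fun z : nwall * nwall => n_conflict z.1 z.2).
Proof. rewrite /n_conflict; ps. Qed.
#[local] Hint Resolve PS_conflict : ps.
Lemma PS_goal : PS (fun z : nat * bool * nsquare => n_goal z.1.1 z.1.2 z.2).
Proof. rewrite /n_goal; ps. Qed.
#[local] Hint Resolve PS_goal : ps.
Lemma PS_squares : PS n_squares.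
Proof. rewrite /n_squares; ps. Qed.
#[local] Hint Resolve PS_squares : ps.
Lemma PS_walls : PS n_walls.
Proof. rewrite /n_walls; ps. Qed.
#[local] Hint Resolve PS_walls : ps.
Lemma PS_grow : PS (fun z : nat * seq nwall * seq nsquare => n_grow z.1.1 z.1.2 z.2).
Proof. rewrite /n_grow; ps. Qed.
#[local] Hint Resolve PS_grow : ps.

Lemma esz_filter {A : Type} {EA : Enc A} (a : pred A) l : esz (filter a l) <= esz l.
Proof.
elim: l => //= x l IH; case: (a x); rewrite ?esz_cons; lia.
Qed.

Lemma PS_reach : PS (fun z : nat * seq nwall * nsquare => n_reach z.1.1 z.1.2 z.2).
Proof.
have [k Hk] := PS_size PS_squares; rewrite /n_reach.
refine (PS_iter (n := fun z : nat * seq nwall * nsquare => z.1.1 * z.1.1)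
  (f := fun z => n_grow z.1.1 z.1.2) (a0 := fun z => [:: z.2])
  (p := fun m => m.+2 ^ k + m + 2) _ _ _ _ _).
- by ps.
- by ps.
- by ps.
- by poly.
case=> [[n W] s] i _ /=; case: i => [|i].
  by rewrite /= esz_cons esz_nil [esz (_, s)]esz_pair /=; lia.
(* After any round the list is a filter of [n_squares n], so sizes do not accumulate. *)
rewrite iterS {1}/n_grow; apply: leq_trans (esz_filter _ _) _.
have := Hk n; have : (esz n).+2 ^ k <= (esz (n, W, s)).+2 ^ k.
  by apply: leq_exp_mono; rewrite !esz_pair /=; lia.
lia.
Qed.
#[local] Hint Resolve PS_reach : ps.
Lemma PS_path : PS (fun z : nat * seq nwall * bool * nsquare => n_path z.1.1 z.1.2 z.2).
Proof. rewrite /n_path; ps. Qed.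
#[local] Hint Resolve PS_path : ps.
Lemma PS_behind : PS (fun z : nsquare * nsquare * nsquare => n_behind z.1.1 z.1.2 z.2).
Proof. rewrite /n_behind; ps. Qed.
#[local] Hint Resolve PS_behind : ps.
Lemma PS_beside : PS (fun z : nsquare * nsquare * nsquare => n_beside z.1.1 z.1.2 z.2).
Proof. rewrite /n_beside; ps. Qed.
#[local] Hint Resolve PS_beside : ps.
Lemma PS_can_move :
  PS (fun z : nat * seq nwall * (nsquare * nsquare) * nsquare => n_can_move z.1.1 z.1.2 z.2).
Proof. rewrite /n_can_move; ps. Qed.
#[local] Hint Resolve PS_can_move : ps.
Lemma PS_can_place : PS (fun z : npos * nwall => n_can_place z.1 z.2).
Proof. rewrite /n_can_place; ps. Qed.
#[local] Hint Resolve PS_can_place : ps.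
Lemma PS_pawn_moves : PS n_pawn_moves.
Proof. rewrite /n_pawn_moves; ps. Qed.
#[local] Hint Resolve PS_pawn_moves : ps.
Lemma PS_move : PS (fun z : npos * nsquare => n_move z.1 z.2).
Proof. rewrite /n_move; ps. Qed.
#[local] Hint Resolve PS_move : ps.
Lemma PS_place : PS (fun z : npos * nwall => n_place z.1 z.2).
Proof. rewrite /n_place; ps. Qed.
#[local] Hint Resolve PS_place : ps.
Lemma PS_kids : PS n_kids.
Proof. rewrite /n_kids; ps. Qed.
#[local] Hint Resolve PS_kids : ps.
Lemma PS_won : PS n_won.
Proof. rewrite /n_won; ps. Qed.
#[local] Hint Resolve PS_won : ps.
Lemma PS_over : PS n_over.
Proof. rewrite /n_over; ps. Qed.
#[local] Hint Resolve PS_over : ps.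
Lemma PS_turn : PS n_turn.
Proof. rewrite /n_turn; ps. Qed.
#[local] Hint Resolve PS_turn : ps.
Lemma PS_depth : PS n_depth.
Proof. rewrite /n_depth; ps. Qed.
#[local] Hint Resolve PS_depth : ps.

(** * Parsing and checking the input *)

Definition lead (w : seq bool) : nat := find negb w.
Definition rest (w : seq bool) : seq bool := drop (lead w).+1 w.

Definition n_bitmap (n : nat) (W : seq nwall) (o : bool) : seq bool :=
  flatten [seq [seq has (eqw (o, (i, j))) W | j <- iota 0 n.-1] | i <- iota 0 n.-1].

Definition n_encode (p : npos) : seq bool :=
  unary p.1.1 ++ (unary p.1.2.1.1 ++ unary p.1.2.1.2) ++
  (unary p.1.2.2.1 ++ unary p.1.2.2.2) ++
  unary p.2.2.1.1 ++ unary p.2.2.1.2 ++ [:: p.2.2.2] ++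
  n_bitmap p.1.1 p.2.1 true ++ n_bitmap p.1.1 p.2.1 false.

(** The bitmaps follow the order of [n_walls], so the index of a wall there is the index of its bit.
    As a filter of [n_walls], the result has no duplicates and stays on the board. *)
Definition n_parse_walls (n : nat) (bits : seq bool) : seq nwall :=
  [seq w <- n_walls n | nth false bits (find (eqw w) (n_walls n))].

Definition n_parse (w : seq bool) : npos :=
  let r1 := rest w in let r2 := rest r1 in let r3 := rest r2 in let r4 := rest r3 in
  let r5 := rest r4 in let r6 := rest r5 in let r7 := rest r6 in
  ((lead w, ((lead r1, lead r2), (lead r3, lead r4))),
   (n_parse_walls (lead w) (behead r7), ((lead r5, lead r6), head false r7))).

Definition eqbits (u v : seq bool) : bool :=
  (size u == size v) && all (fun i => nth false u i == nth false v i) (iota 0 (size u)).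

Definition n_valid (p : npos) : bool :=
  [&& (p.1.2.1.1 < p.1.1) && (p.1.2.1.2 < p.1.1), (p.1.2.2.1 < p.1.1) && (p.1.2.2.2 < p.1.1),
      ~~ eqsq p.1.2.1 p.1.2.2, ~~ (n_won p && n_goal p.1.1 false p.1.2.2),
      all (fun w => all (fun v => eqw w v || ~~ n_conflict w v) p.2.1) p.2.1,
      n_path (p.1.1, p.2.1) true p.1.2.1 && n_path (p.1.1, p.2.1) false p.1.2.2 &
      size p.2.1 + p.2.2.1.1 + p.2.2.1.2 <= p.1.1 * p.1.1].

Definition n_win : nat -> npos -> bool := win n_kids n_over n_won n_turn.

(** [n_parse] is total and returns some tuple on malformed words too; comparison with the re-encoded
    result rejects these. *)
Definition n_quoridor (w : seq bool) : bool :=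
  [&& eqbits w (n_encode (n_parse w)), n_valid (n_parse w) &
      n_win (n_depth (n_parse w)) (n_parse w)].

Lemma mem_squares n s : (s \in n_squares n) = (s.1 < n) && (s.2 < n).
Proof.
apply/flatten_mapP/idP => [[i] | /andP[H1 H2]].
  by rewrite mem_iota add0n => /= Hi /mapP[j]; rewrite mem_iota add0n => /= Hj -> /=; rewrite Hi.
exists s.1; first by rewrite mem_iota add0n.
by apply/mapP; exists s.2; rewrite ?mem_iota ?add0n //; case: (s).
Qed.

Lemma mem_walls n w : (w \in n_walls n) = (w.2 \in n_squares n.-1).
Proof.
rewrite mem_cat; case: w => -[] s /=.
  rewrite mem_map; last by move=> ? ? [].
  by rewrite orbC; case: mapP => [[? _ []]|].
rewrite (mem_map (f := fun s => (false, s))); last by move=> ? ? [].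
by case: mapP => [[? _ []]|].
Qed.

(** A pawn move lands below [n], which [maxn] has already paid for, even from a tuple with
    coordinates out of range. Placing a wall lowers a supply by one and so releases [4 * n + 12],
    enough for an entry of size at most [4 * n + 8] and its list constructor. *)
Definition n_bound (p : npos) : nat :=
  40 + 2 * p.1.1 +
  2 * (maxn p.1.1 p.1.2.1.1 + maxn p.1.1 p.1.2.1.2 + maxn p.1.1 p.1.2.2.1 + maxn p.1.1 p.1.2.2.2)
  + esz p.2.1 + (p.2.2.1.1 + p.2.2.1.2) * (4 * p.1.1 + 12).

Lemma n_bound_kids p : all (fun q => n_bound q <= n_bound p) (n_kids p).
Proof.
case: p => -[n [wp bp]] [W [[ws bs] c]].
rewrite /n_kids all_cat !all_map !all_filter; apply/andP; split; apply/allP.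
  move=> [i j]; rewrite mem_squares => /andP[/= H1 H2]; apply/implyP => _.
  by rewrite /n_move /=; case: c; rewrite /n_bound /=; lia.
move=> w; move: (w : nwall) => {w} [o [i j]]; rewrite mem_walls mem_squares => /andP[/= H1 H2]; apply/implyP => /andP[/= sup _].
have szx : esz (o, (i, j)) <= 4 * n + 8.
  by rewrite !esz_pair /= !esz_nat; have := esz_bool o; lia.
case: c sup => sup; rewrite /n_place /n_bound /= [esz (_ :: _)]esz_cons.
  rewrite [in leqRHS](_ : ws + bs = (ws.-1 + bs).+1) ?mulSn; last by lia.
  by set P := ((_ + _) * (_ + 12)); lia.
rewrite [in leqRHS](_ : ws + bs = (ws + bs.-1).+1) ?mulSn; last by lia.
by set P := ((_ + _) * (_ + 12)); lia.
Qed.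

Lemma esz_n_bound p : esz p <= n_bound p.
Proof.
case: p => -[n [[a b] [c d]]] [W [[ws bs] t]]; rewrite !esz_pair /= !esz_nat /n_bound /=.
by have := esz_bool t; nia.
Qed.

Lemma PS_n_win : PS (fun z : nat * npos => n_win z.1 z.2).
Proof.
have [q Hq] : poly (fun m => 40 + 2 * m + 2 * (m + m + m + m) + m + m * (4 * m + 12)) by poly.
refine (PS_win (b := n_bound) (q := q) PS_kids PS_over PS_won PS_turn _ esz_n_bound n_bound_kids).
move=> p; apply: leq_trans (Hq _); set m := esz p.
have Hm : [/\ p.1.1 <= m, [/\ p.1.2.1.1 <= m, p.1.2.1.2 <= m, p.1.2.2.1 <= m & p.1.2.2.2 <= m],
    esz p.2.1 <= m & p.2.2.1.1 + p.2.2.1.2 <= m].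
  by rewrite /m !esz_pair !esz_nat; split; [| split| |]; lia.
case: Hm => H1 [H2 H3 H4 H5] H6 H7; rewrite /n_bound.
have := leq_mul H7 (_ : 4 * p.1.1 + 12 <= 4 * m + 12); rewrite leq_add2r leq_mul2l H1 => /(_ isT).
lia.
Qed.
#[local] Hint Resolve PS_n_win : ps.

Lemma PS_lead : PS lead. Proof. rewrite /lead; ps. Qed.
#[local] Hint Resolve PS_lead : ps.
Lemma PS_rest : PS rest. Proof. rewrite /rest; ps. Qed.
#[local] Hint Resolve PS_rest : ps.
Lemma PS_bitmap : PS (fun z : nat * seq nwall * bool => n_bitmap z.1.1 z.1.2 z.2).
Proof. rewrite /n_bitmap; ps. Qed.
#[local] Hint Resolve PS_bitmap : ps.
Lemma PS_encode : PS n_encode.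
Proof. rewrite /n_encode; ps. Qed.
#[local] Hint Resolve PS_encode : ps.
Lemma PS_parse_walls : PS (fun z : nat * seq bool => n_parse_walls z.1 z.2).
Proof. rewrite /n_parse_walls; ps. Qed.
#[local] Hint Resolve PS_parse_walls : ps.
Lemma PS_parse : PS n_parse.
Proof. rewrite /n_parse; ps. Qed.
#[local] Hint Resolve PS_parse : ps.
Lemma PS_eqbits : PS (fun z : seq bool * seq bool => eqbits z.1 z.2).
Proof. rewrite /eqbits; ps. Qed.
#[local] Hint Resolve PS_eqbits : ps.
Lemma PS_valid : PS n_valid.
Proof. rewrite /n_valid; ps. Qed.
#[local] Hint Resolve PS_valid : ps.
Lemma PS_n_quoridor : PS n_quoridor.
Proof. rewrite /n_quoridor; ps. Qed.

(** * From input words to trees *)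

Definition load_input : cmd :=
  Seq (move_all inp aux) (Seq (Push main false)
   (WhileTop aux nonempty (Seq (If_true aux
       (Seq (Pop aux) (Seq (Push main false) (Seq (Push main false) (Push main true))))
       (Seq (Pop aux) (Push main false))) (Push main true)))).

(** The word lies reversed on [aux], so the list is built from its last bit: the initial [false] is
    the empty list, and each bit is pushed as a tree and then joined to the tail by [true]. *)
Lemma load_inputP w h : esz w <= h ->
  exec h load_input (Stacks w [::] [::] [::]) (mainst (code (enc w))).
Proof.
move=> H; generalize (size_esz w); rewrite -/(esz w) => Hw.
apply: ESeq; first by apply: move_all_21; rewrite /=; lia.
apply: ESeq; first by apply: EPush => /=; generalize (esz_gt0 w); lia.
have K s t : esz (rev s ++ t) <= h -> exec h (WhileTop aux nonempty (Seq (If_true aux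
       (Seq (Pop aux) (Seq (Push main false) (Seq (Push main false) (Push main true))))
       (Seq (Pop aux) (Push main false))) (Push main true)))
    (Stacks [::] (code (enc t)) s [::]) (mainst (code (enc (rev s ++ t)))).
  elim: s t => [|b s IH] t Hs; first exact: EWhileF.
  move: Hs; rewrite rev_cons cat_rcons => Hs.
  have Hb : esz (b :: t) <= h by generalize (esz_cat (rev s) (b :: t)); generalize (esz_gt0 (rev s)); lia.
  apply: (@EWhileT _ _ _ _ _ (Stacks [::] (code (enc (b :: t))) s [::])) => //; last exact: IH.
  move: Hb; rewrite esz_cons /esz => Hb.
  apply: ESeq; last first.
    refine (@EPush h main true (Stacks [::] (code (enc b) ++ code (enc t)) s [::]) _).
    by rewrite /= size_cat; lia.
  apply: (EIfB (b := b)) => //; case: b Hb {Hs} => /= Hb; apply: ESeq; try exact: EPop.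
    by apply: ESeq; [apply: EPush => /=; lia| apply: ESeq; apply: EPush => /=; lia].
  by apply: EPush => /=; lia.
have := K (rev w) [::]; rewrite revK cats0; exact.
Qed.

Theorem PSPACE_PS (L : language) (f : seq bool -> bool) : PS f ->
  (forall w, f w <-> L w) -> PSPACE L.
Proof.
move=> [c [k Hc]] HL.
have esz_w (w : seq bool) : esz w <= 4 * size w + 1.
  elim: w => // b w IH; rewrite esz_cons /=; have := esz_bool b; lia.
have [e He] : poly (fun m => 4 * ((4 * m + 1) + (4 * m + 1).+2 ^ k).+1) .
  apply: (@poly_le _ (fun m => 4 * ((4 * m + 1) + (4 * m + 1).+2 ^ k + 1))); last by poly.
  by move=> m; set X := _ ^ k; lia.
exists e; apply: (@SPACE_stack_program L (Seq load_input c)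
  (fun m => (4 * m + 1) + (4 * m + 1).+2 ^ k)).
  move=> w; exists (f w), (mainst (code (enc (f w)))); split.
  - by generalize (esz_w w); lia.
  - apply: ESeq; first by apply: load_inputP; generalize (esz_w w); lia.
    generalize (Hc w [::]); rewrite !cats0 add0n; apply: exec_leq.
    apply: leq_trans (leq_addl _ _); apply: leq_exp_mono; exact: esz_w.
  - by case: (f w).
  - by rewrite -HL.
(* For positive [m] one has [m + 2 <= 3 * m]; at [m = 0] the additive constant suffices. *)
exists (3 ^ e) => m; apply: leq_trans (He m) _.
case: m => [|m]; first by apply: leq_trans (leq_addl _ _); case: (e) => // e'; rewrite leq_exp2r.
apply: leq_trans (leq_addr _ _); rewrite -expnMn; case: (e) => // e'; rewrite leq_exp2r //; lia.
Qed.

(** * Correctness of the natural-number version *)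

Definition nat_square n (s : square n) : nsquare := (val s.1, val s.2).
Definition nat_wall n (w : wall n) : nwall := (w.1, (val w.2.1, val w.2.2)).
Definition is_white (c : player) : bool := if c is White then true else false.

Definition all_squares n : seq (square n) :=
  flatten [seq [seq (i, j) | j <- enum 'I_n] | i <- enum 'I_n].
Definition all_walls n : seq (wall n) :=
  [seq (true, c) | c <- all_squares n.-1] ++
  [seq (false, c) | c <- all_squares n.-1].

Lemma mem_all_squares n (s : square n) : s \in all_squares n.
Proof.
apply/flatten_mapP; exists s.1; first by rewrite mem_enum.
by apply/mapP; exists s.2; rewrite ?mem_enum //; case: s.
Qed.

Lemma mem_all_walls n (w : wall n) : w \in all_walls n.
Proof.
have := @mem_all_squares n.-1 w.2; rewrite mem_cat; case: w => -[] c /= Hc; apply/orP.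
  by left; rewrite map_f.
by right; rewrite map_f.
Qed.

Lemma n_squaresE n : n_squares n = [seq nat_square s | s <- all_squares n].
Proof.
rewrite /n_squares /all_squares map_flatten -val_enum_ord -!map_comp; congr flatten.
by apply: eq_map => i /=; rewrite -!map_comp.
Qed.

Lemma n_wallsE n : n_walls n = [seq nat_wall w | w <- all_walls n].
Proof.
by rewrite /n_walls /all_walls map_cat n_squaresE -!map_comp.
Qed.

Lemma nat_square_inj n : injective (@nat_square n).
Proof. by move=> [a b] [c d] [] /val_inj -> /val_inj ->. Qed.

Lemma nat_wall_inj n : injective (@nat_wall n).
Proof. by move=> [o [a b]] [o' [c d]] [] -> /val_inj -> /val_inj ->. Qed.

Lemma eqsqE (s t : nsquare) : eqsq s t = (s == t).
Proof. by case: s t => [a b] [c d]; rewrite /eqsq xpair_eqE. Qed.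

Lemma eqwE (w v : nwall) : eqw w v = (w == v).
Proof. by case: w v => [o s] [o' t]; rewrite /eqw eqsqE xpair_eqE. Qed.

Lemma eqbitsE u v : eqbits u v = (u == v).
Proof.
apply/andP/eqP => [[/eqP E /allP H]|->]; last by split=> //; apply/allP => i.
apply: (eq_from_nth (x0 := false)) => // i Hi; apply/eqP/H; by rewrite mem_iota.
Qed.

Section Board.
Variable n : nat.
Implicit Types (s t o : square n) (w v : wall n) (W : {set wall n}) (V : seq nwall).

(** Only membership is compared, so a new wall can be put in front whatever the order of [enum]. *)
Definition lists V W := V =i [seq nat_wall w | w <- enum W].

Lemma lists_has V W a : lists V W -> has a V = [exists w in W, a (nat_wall w)].
Proof.
move=> H; rewrite (eq_has_r H) has_map; apply/hasP/exists_inP => -[w].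
  by rewrite mem_enum => H1 H2; exists w.
by move=> H1 H2; exists w; rewrite ?mem_enum.
Qed.

Lemma lists_all V W a : lists V W -> all a V = [forall w in W, a (nat_wall w)].
Proof.
move=> H; rewrite -[LHS]negbK -has_predC (lists_has _ H) negb_exists_in.
by apply: eq_forallb_in => w _; rewrite negbK.
Qed.

Lemma lists_add V W w : lists V W -> lists (nat_wall w :: V) (w |: W).
Proof.
move=> H v; rewrite inE H; apply/orP/mapP => [[/eqP ->|/mapP[u]]|[u]].
- by exists w; rewrite // mem_enum setU11.
- by rewrite mem_enum => Hu ->; exists u; rewrite // mem_enum inE Hu orbT.
rewrite mem_enum !inE => /orP[/eqP ->|Hu] ->; first by left.
by right; rewrite map_f // mem_enum.
Qed.

Lemma nat_square_eq s t : (nat_square s == nat_square t) = (s == t).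
Proof. exact: (inj_eq (@nat_square_inj n)). Qed.

Lemma nat_wall_eq w v : (nat_wall w == nat_wall v) = (w == v).
Proof. exact: (inj_eq (@nat_wall_inj n)). Qed.

Lemma has_squares a : has a (n_squares n) = [exists s : square n, a (nat_square s)].
Proof.
rewrite n_squaresE has_map; apply/hasP/existsP => -[s]; first by exists s.
by move=> H; exists s; rewrite ?mem_all_squares.
Qed.

Lemma n_openE V W s t : lists V W -> n_open V (nat_square s) (nat_square t) = Defs.open W s t.
Proof. by move=> H; rewrite /n_open (lists_all _ H). Qed.

Lemma n_conflictE w v : n_conflict (nat_wall w) (nat_wall v) = conflict w v.
Proof.
case: w v => [o [a b]] [o' [c d]].
by rewrite /n_conflict /conflict /eqsq xpair_eqE /= !val_eqE.
Qed.

Lemma mem_reach V W s k (t' : nsquare) : lists V W ->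
  reflect (exists (t : square n) p,
      [/\ t' = nat_square t, path (Defs.open W) s p, last s p = t & size p <= k])
    (t' \in iter k (n_grow n V) [:: nat_square s]).
Proof.
move=> HV; elim: k t' => [|k IH] t'.
  rewrite /= inE; apply: (iffP eqP) => [->|[t [p [-> _ <-]]]]; first by exists s, [::].
  by case: p.
rewrite iterS mem_filter; apply: (iffP andP).
  move=> [/hasP[u /IH[x [p [-> Hp Hl Hk]]]]].
  rewrite n_squaresE => H /mapP[t _ Et]; exists t; move: H; rewrite Et.
  rewrite eqsqE nat_square_eq => /orP[/eqP <-|].
    by exists p; split=> //; apply: leqW.
  rewrite (n_openE _ _ HV) => Ho; exists (rcons p t); split=> //.
  - by rewrite rcons_path Hp Hl.
  - by rewrite last_rcons.
  - by rewrite size_rcons.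
move=> [t [p [-> Hp Hl Hk]]]; split; last by rewrite n_squaresE map_f ?mem_all_squares.
case/lastP: p Hp Hl Hk => [|p x].
  move=> _ /= <- _; apply/hasP; exists (nat_square s); last by rewrite eqsqE eqxx.
  by apply/IH; exists s, [::].
rewrite rcons_path last_rcons size_rcons => /andP[Hp Ho] <- Hk.
apply/hasP; exists (nat_square (last s p)); last by rewrite (n_openE _ _ HV) Ho orbT.
by apply/IH; exists (last s p), p.
Qed.

Lemma n_goalE c s : n_goal n (is_white c) (nat_square s) = goal c s.
Proof. by case: c. Qed.

Lemma n_pathE V W c s : lists V W -> n_path (n, V) (is_white c) (nat_square s) = has_path W c s.
Proof.
move=> HV; apply/hasP/existsP => [[t' /(mem_reach _ _ _ HV)[t [p [-> Hp Hl _]]]]|[t /andP[Hg Hc]]].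
  by rewrite /= n_goalE => Hg; exists t; rewrite Hg; apply/connectP; exists p.
exists (nat_square t); last by rewrite /= n_goalE.
apply/(mem_reach _ _ _ HV); exists t.
case/connectP: Hc => p Hp Hl; case/shortenP: Hp Hl => p' Hp' Up _ Hl.
exists p'; split=> //; have := card_uniqP Up => /= E.
have := max_card (mem (s :: p')); rewrite E card_prod card_ord => H; exact: ltnW.
Qed.

Lemma n_can_moveE V W s o t : lists V W ->
  n_can_move (n, V) (nat_square s, nat_square o) (nat_square t) = pawn_can_move W s o t.
Proof.
move=> HV; have bE u x y : n_behind (nat_square u) (nat_square x) (nat_square y) = behind u x y.
  by rewrite /n_behind /behind !addnn.
rewrite /n_can_move /pawn_can_move has_squares /= !(n_openE _ _ HV) eqsqE nat_square_eq bE.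
congr [|| _, _ | [&& _, ~~ _, _ & _]].
by apply: eq_existsb => u; rewrite (n_openE _ _ HV) bE.
Qed.

Definition npos_of (P : position n) V : npos :=
  ((n, (nat_square (white_pawn P), nat_square (black_pawn P))),
   (V, ((white_supply P, black_supply P), is_white (turn P)))).

Definition represents (p : npos) (P : position n) := exists2 V, lists V (walls P) & p = npos_of P V.

End Board.

Lemma nilp_has T (s : seq T) : nilp s = ~~ has predT s.
Proof. by case: s. Qed.

Lemma map_iota T (f : nat -> T) n : [seq f i | i <- iota 0 n] = [seq f (val i) | i <- enum 'I_n].
Proof. by rewrite -val_enum_ord -map_comp. Qed.

(** * Moves, validity and encoding of represented positions *)

Section Moves.
Variable n : nat.
Implicit Types (P Q : position n) (p q : npos).

Definition kids P : seq (position n) :=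
  [seq move_pawn P t | t <- all_squares n &
     pawn_can_move (walls P) (pawn P (turn P)) (pawn P (opponent (turn P))) t] ++
  [seq place_wall P w | w <- all_walls n & wall_can_be_placed P w].
Definition won P : bool := at_goal P White.
Definition finished P : bool := won P || at_goal P Black.
Definition white_to_move P : bool := is_white (turn P).
Definition p_win : nat -> position n -> bool := win kids finished won white_to_move.

(** [position n] has no [eqType] structure here, so the list of successors is specified through
    predicates instead of membership. *)
Lemma has_kidsP (a : pred (position n)) P :
  reflect (exists2 Q, legal_move P Q & a Q) (has a (kids P)).
Proof.
rewrite has_cat !has_map; apply: (iffP orP) => [[]|[Q []]].
- case/hasP=> t; rewrite mem_filter => /andP[Ht _] Ha.
  by exists (move_pawn P t) => //; constructor.
- case/hasP=> w; rewrite mem_filter => /andP[Hw _] Ha.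
  by exists (place_wall P w) => //; constructor.
- by move=> t Ht Ha; left; apply/hasP; exists t; rewrite // mem_filter mem_all_squares andbT.
- by move=> w Hw Ha; right; apply/hasP; exists w; rewrite // mem_filter mem_all_walls andbT.
Qed.

Lemma wonE p P : represents p P -> n_won p = won P.
Proof. by move=> [V _ ->]. Qed.

Lemma overE p P : represents p P -> n_over p = finished P.
Proof. by move=> H; rewrite /n_over (wonE H); case: H => V _ ->. Qed.

Lemma represents_move p P t :
  represents p P -> represents (n_move p (nat_square t)) (move_pawn P t).
Proof.
move=> [V HV ->]; case: P HV => wp bp W ws bs [] HV; exists V => //.
Qed.

Lemma represents_place p P w :
  represents p P -> represents (n_place p (nat_wall w)) (place_wall P w).
Proof.
move=> [V HV ->]; case: P HV => wp bp W ws bs c /= HV.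
by case: c; exists (nat_wall w :: V) => //; apply: lists_add.
Qed.

Lemma can_placeE p P w : represents p P -> n_can_place p (nat_wall w) = wall_can_be_placed P w.
Proof.
move=> [V HV ->]; rewrite /n_can_place /wall_can_be_placed /=.
have HV' := lists_add w HV.
rewrite (n_pathE White _ HV') (n_pathE Black _ HV') (lists_all _ HV).
congr [&& _, _, _ & _]; first by case: P HV HV' => ? ? ? ? ? [].
Qed.

Lemma has_kids (a : pred npos) (b : pred (position n)) p P : represents p P ->
  (forall q Q, represents q Q -> a q = b Q) -> has a (n_kids p) = has b (kids P).
Proof.
move=> H Hab; have En : p.1.1 = n by case: H => V _ ->.
rewrite /n_kids /n_pawn_moves En n_squaresE n_wallsE !filter_map -!map_comp !has_cat !has_map.
congr (_ || _).
  rewrite (eq_filter (a2 := fun t => pawn_can_move (walls P) (pawn P (turn P)) (pawn P (opponent (turn P))) t)).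
    by apply: eq_has => t /=; apply/Hab/represents_move.
  move=> t /=; case: H => V HV -> /=; rewrite -(n_can_moveE _ _ _ HV).
  by case: P HV => ? ? ? ? ? [].
rewrite (eq_filter (a2 := fun w => wall_can_be_placed P w)).
  by apply: eq_has => t /=; apply/Hab/represents_place.
by move=> w /=; apply: can_placeE.
Qed.

Lemma winE k p P : represents p P -> n_win k p = p_win k P.
Proof.
rewrite /n_win /p_win; elim: k p P => [|k IH] p P H /=; rewrite (overE H) (wonE H);
  have -> : nilp (n_kids p) = nilp (kids P) by
    rewrite !nilp_has (has_kids (b := predT) H).
- by [].
- rewrite (has_kids H IH); have -> : n_turn p = white_to_move P by case: H => V _ ->.
  rewrite -[all _ (n_kids p)]negbK -[all _ (kids P)]negbK -!has_predC.
  by rewrite (has_kids (b := predC (p_win k)) H) // => q Q /IH /= ->.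
Qed.

Lemma encodeE p P : represents p P -> n_encode p = encode P.
Proof.
move=> [V HV ->]; rewrite /n_encode /encode /=.
have E o : n_bitmap n V o = wall_bitmap (walls P) o.
  rewrite /n_bitmap /wall_bitmap map_iota; congr flatten.
  apply: eq_map => i /=; rewrite map_iota; apply: eq_map => j /=.
  rewrite (lists_has _ HV); apply/exists_inP/idP => [[w Hw]|Hw].
    by rewrite eqwE -[(o, _)]/(nat_wall (o, (i, j))) nat_wall_eq => /eqP ->.
  by exists (o, (i, j)); rewrite // eqwE.
by rewrite !E.
Qed.

(** Without duplicates the length of the list is the cardinal of the set of walls, which the count
    of wall pieces refers to. *)
Lemma validE p P : represents p P -> uniq p.2.1 -> n_valid p <-> valid_position P.
Proof.
move=> [V HV ->] /= UV.
have sz : size V = #|walls P|.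
  rewrite cardE -(size_map (@nat_wall n)); apply/perm_size/uniq_perm => //.
  by rewrite map_inj_uniq ?enum_uniq //; apply: nat_wall_inj.
rewrite /n_valid /= !ltn_ord /= sz eqsqE nat_square_eq.
rewrite (n_pathE White _ HV) (n_pathE Black _ HV) mulnn.
have -> : all (fun w => all (fun v => eqw w v || ~~ n_conflict w v) V) V =
   [forall w in walls P, forall v in walls P, (w != v) ==> ~~ conflict w v].
  rewrite (lists_all _ HV); apply: eq_forallb_in => w _; rewrite (lists_all _ HV).
  by apply: eq_forallb_in => v _; rewrite eqwE nat_wall_eq n_conflictE implyNb.
split.
  case/and5P=> H1 H2 /forall_inP H3 /andP[H4 H5] H6; split=> //.
  by move=> w v Hw Hv; move/(_ w Hw)/forall_inP/(_ v Hv)/implyP: H3.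
case=> H1 H2 H3 [H4 H5] H6; apply/and5P; split=> //; last by rewrite H4.
by apply/forall_inP => w Hw; apply/forall_inP => v Hv; apply/implyP; apply: H3.
Qed.

Lemma lead_unary m s : lead (unary m ++ s) = m.
Proof. by rewrite /lead /unary cat_rcons; elim: m => //= m ->. Qed.

Lemma rest_unary m s : rest (unary m ++ s) = s.
Proof.
rewrite /rest lead_unary /unary drop_cat size_rcons size_nseq ltnn subnn drop0 //.
Qed.

Lemma uniq_all_squares m : uniq (all_squares m).
Proof. by apply: allpairs_uniq; rewrite ?enum_uniq // => -[a b] [c d] _ _ /= [-> ->]. Qed.

Lemma uniq_all_walls : uniq (all_walls n).
Proof.
rewrite cat_uniq !map_inj_uniq ?uniq_all_squares ?andbT /=; try by move=> ? ? [].
by apply/hasPn => x /mapP[c _ ->]; apply/mapP => -[].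
Qed.

Lemma uniq_n_walls : uniq (n_walls n).
Proof. by rewrite n_wallsE map_inj_uniq ?uniq_all_walls //; apply: nat_wall_inj. Qed.

Lemma bitmapE (W : {set wall n}) :
  wall_bitmap W true ++ wall_bitmap W false = [seq w \in W | w <- all_walls n].
Proof.
rewrite /wall_bitmap /all_walls map_cat /all_squares -!map_comp !map_flatten -!map_comp.
by congr (flatten _ ++ flatten _); apply: eq_map => i /=; rewrite -!map_comp.
Qed.

Lemma parse_encode P : exists2 V, lists V (walls P) & n_parse (encode P) = npos_of P V.
Proof.
exists (n_parse_walls n (wall_bitmap (walls P) true ++ wall_bitmap (walls P) false)); last first.
  by rewrite /n_parse /encode /encode_square -!catA !(rest_unary, lead_unary).
move=> v; rewrite bitmapE mem_filter n_wallsE andbC.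
have Ef w : find (eqw (nat_wall w)) [seq nat_wall w | w <- all_walls n] = index w (all_walls n).
  rewrite find_map /index; apply: eq_find => u /=; by rewrite eqwE nat_wall_eq eq_sym.
apply/andP/mapP => [[/mapP[w Hw ->]]|[w]].
  rewrite Ef (nth_map w) ?index_mem // nth_index // => H.
  by exists w; rewrite ?mem_enum.
rewrite mem_enum => Hw ->; split; first by rewrite map_f ?mem_all_walls.
by rewrite Ef (nth_map w) ?index_mem ?mem_all_walls // nth_index ?mem_all_walls.
Qed.

End Moves.

Lemma represents_exists p : p.1.2.1.1 < p.1.1 -> p.1.2.1.2 < p.1.1 -> p.1.2.2.1 < p.1.1 ->
  p.1.2.2.2 < p.1.1 -> {subset p.2.1 <= n_walls p.1.1} -> exists P : position p.1.1, represents p P.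
Proof.
case: p => -[n [[a b] [c d]]] [V [[ws bs] t]] /= Ha Hb Hc Hd HV.
pose W := [set w : wall n | nat_wall w \in V].
exists (Position (Ordinal Ha, Ordinal Hb) (Ordinal Hc, Ordinal Hd) W ws bs (if t then White else Black)).
exists V; last by case: t.
move=> v; apply/idP/mapP => [Hv|[w]]; last by rewrite mem_enum inE => H ->.
have := HV _ Hv; rewrite n_wallsE => /mapP[w _ E]; exists w => //.
by rewrite mem_enum inE -E.
Qed.

(** * The game *)

Section Game.
Variable n : nat.
Implicit Types (P Q : position n).

Definition liveb P : bool := ~~ finished P && has predT (kids P).

Lemma liveP P : reflect (live P) (liveb P).
Proof.
apply: (iffP andP) => [[]|[H1 [H2 [Q HQ]]]].
  by rewrite negb_or => /andP[H1 H2] /has_kidsP[Q HQ _]; split; [|split; [|exists Q]].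
by split; [rewrite negb_or H1 | apply/has_kidsP; exists Q].
Qed.

Lemma p_winS k P : p_win k.+1 P =
  if liveb P then (if white_to_move P then has (p_win k) (kids P) else all (p_win k) (kids P))
  else won P.
Proof. by rewrite /p_win /= nilp_has /liveb; case: (finished P); case: has. Qed.

Lemma p_win0 P : p_win 0 P = won P.
Proof. by rewrite /p_win /=; case: ifP. Qed.

Lemma all_kidsP (a : pred (position n)) P :
  reflect (forall Q, legal_move P Q -> a Q) (all a (kids P)).
Proof.
rewrite -[all _ _]negbK -has_predC; apply: (iffP idP) => [/negP H Q HQ|H].
  by apply/negPn/negP => aQ; apply: H; apply/has_kidsP; exists Q.
by apply/has_kidsP => -[Q HQ]; rewrite /= H.
Qed.

Lemma has_kids_eq (a b : pred (position n)) P : (forall Q, legal_move P Q -> a Q = b Q) ->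
  has a (kids P) = has b (kids P).
Proof.
move=> H; apply/has_kidsP/has_kidsP => -[Q HQ]; first by rewrite H //; exists Q.
by rewrite -H //; exists Q.
Qed.

Lemma all_kids_eq (a b : pred (position n)) P : (forall Q, legal_move P Q -> a Q = b Q) ->
  all a (kids P) = all b (kids P).
Proof.
move=> H; rewrite -[LHS]negbK -[RHS]negbK -!has_predC; congr (~~ _).
by apply: has_kids_eq => Q /H /= ->.
Qed.

Lemma won_not_live P : won P -> liveb P = false.
Proof. by rewrite /liveb /finished => ->. Qed.

(** A leaf counts as a win only if White has already won, and such a position is not live, so it
    keeps its value at any depth. *)
Lemma p_win_leq k k' P : k <= k' -> p_win k P -> p_win k' P.
Proof.
elim: k k' P => [|k IH] [|k'] P //; rewrite ?p_win0 ?p_winS.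
  by move=> _ H; rewrite (won_not_live H).
move=> le; case: ifP => // _; case: ifP => _.
  by move=> /has_kidsP[Q HQ HW]; apply/has_kidsP; exists Q => //; apply: IH HW.
by move=> /all_kidsP H; apply/all_kidsP => Q /H; apply: IH.
Qed.

Definition supplies P := white_supply P + black_supply P.

Notation spot := (square n * square n * bool)%type.
Definition set_spot P (x : spot) : position n :=
  Position x.1.1 x.1.2 (walls P) (white_supply P) (black_supply P) (if x.2 then White else Black).
Definition the_spot P : spot := (white_pawn P, black_pawn P, white_to_move P).

Lemma set_the_spot P : set_spot P (the_spot P) = P.
Proof. by case: P => ? ? ? ? ? []. Qed.

Lemma legal_supplies P Q : legal_move P Q ->
  (exists x, Q = set_spot P x) \/ supplies Q < supplies P.
Proof.
case=> [t _|w].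
  left; case: P => wp bp W ws bs [] /=; [by exists (t, bp, false) | by exists (wp, t, true)].
move=> /andP[H _]; right; case: P H => wp bp W ws bs [] /=; rewrite /supplies /=; lia.
Qed.

(* Before the next wall is placed only the [spot] changes; once every position
   with fewer supplies has stabilised, the increasing sets of won spots satisfy
   a first-order recurrence, hence are constant from the first repetition. *)
Lemma p_win_stable k P : p_win k P -> p_win (#|{: spot}| * (supplies P).+1) P.
Proof.
set N := #|_|; move Eu: (supplies P) => u; move: u P k Eu.
elim/ltn_ind=> u IHu P k Eu Hk.
pose A k := [set x | p_win k (set_spot P x)].
have Amono i j : i <= j -> A i \subset A j.
  by move=> le; apply/subsetP => x; rewrite !inE; apply: p_win_leq.
(* Positions with fewer supplies are stable from depth [N * u] on, by the induction hypothesis. *)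
have HA j Q : supplies Q < u -> N * u <= j -> p_win j Q = p_win (N * u) Q.
  move=> lt le; apply/idP/idP; last exact: p_win_leq.
  move=> /(IHu _ lt _ _ erefl); apply: p_win_leq; by rewrite leq_mul2l lt orbT.
(* A successor either differs in the spot only, where the assumed repetition applies, or has fewer
   supplies, where [HA] applies. *)
have stepA i : A (N * u + i) = A (N * u + i).+1 -> A (N * u + i).+1 = A (N * u + i).+2.
  move=> E; apply/setP => x; rewrite !inE !p_winS.
  have K Q : legal_move (set_spot P x) Q -> p_win (N * u + i) Q = p_win (N * u + i).+1 Q.
    move=> /legal_supplies[[y ->]|].
      by move/setP/(_ y): E; rewrite !inE.
    rewrite /supplies /= -/(supplies P) Eu => lt.
    rewrite (HA (N * u + i) Q lt (leq_addr _ _)); exact: (esym (HA _ Q lt (leqW (leq_addr _ _)))).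
  by rewrite (has_kids_eq K) (all_kids_eq K).
have [i iN Ei] : exists2 i, i <= N & A (N * u + i) = A (N * u + i).+1.
  case: (boolP [exists i : 'I_N.+1, A (N * u + i) == A (N * u + i).+1]).
    by case/existsP=> i /eqP E; exists i => //; rewrite -ltnS.
  move=> /existsPn H; exfalso.
  (* Without a repetition each step adds a spot, so after [N.+1] steps there would be more than [N]
     spots. *)
  have K i : i <= N.+1 -> i <= #|A (N * u + i)|.
    elim: i => // i IHi lt; apply: leq_ltn_trans (IHi (ltnW lt)) _; apply: proper_card.
    rewrite properEneq addnS Amono ?leqnSn // andbT.
    exact: (H (Ordinal lt)).
  have := leq_trans (K _ (leqnn _)) (max_card _); by rewrite ltnn.
have const j : A (N * u + i + j) = A (N * u + i) /\ A (N * u + i + j) = A (N * u + i + j).+1.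
  elim: j => [|j [IH1 IH2]]; first by rewrite addn0.
  split; first by rewrite addnS -IH2.
  by rewrite addnS -addnA -addnS; move: IH2; rewrite -addnA => /stepA; rewrite addnS.
have : the_spot P \in A (N * u + i + k).
  rewrite inE set_the_spot; apply: p_win_leq Hk; exact: leq_addl.
rewrite (proj1 (const k)) inE set_the_spot; apply: p_win_leq.
by rewrite mulnS addnC leq_add2r.
Qed.

Lemma legal_supplies_leq P Q : legal_move P Q -> supplies Q <= supplies P.
Proof. by move=> /legal_supplies[[x ->]|/ltnW]. Qed.

Lemma nth_map_legal (T : eqType) (f : T -> position n) (s : seq T) P i :
  (forall x, x \in s -> legal_move P (f x)) -> i < size s -> legal_move P (nth P (map f s) i).
Proof.
move=> H lt; have x0 : T by case: s lt {H}.
by rewrite (nth_map x0) //; apply/H/mem_nth.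
Qed.

Lemma nth_kids_legal P i : i < size (kids P) -> legal_move P (nth P (kids P) i).
Proof.
rewrite /kids size_cat nth_cat !size_map; case: ifPn => [lt _|]; last rewrite -leqNgt => ge lt.
  apply: (@nth_map_legal _ (move_pawn P)) => // x; rewrite mem_filter => /andP[H _].
  exact: PawnMove.
apply: (@nth_map_legal _ (place_wall P)) => [x|]; last by rewrite ltn_subLR.
by rewrite mem_filter => /andP[H _]; apply: WallMove.
Qed.

(* White moves to a won position of least possible rank. *)
Definition win_strategy (K : nat) (P0 : position n) : strategy n := fun h =>
  let P := last P0 h in
  let k := find (fun k => has (p_win k) (kids P)) (iota 0 K) in
  if has (p_win k) (kids P) then nth P (kids P) (find (p_win k) (kids P))
  else head P (kids P).

Lemma p_win_can_force_win K P0 : p_win K P0 -> white_can_force_win P0.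
Proof.
move=> HK; exists (win_strategy K P0); split.
  move=> h P _ /liveP /andP[_ Hh]; rewrite /win_strategy last_rcons.
  set k := find _ _; case: ifP => [H|_]; first by apply: nth_kids_legal; rewrite -has_find.
  by rewrite -nth0; apply: nth_kids_legal; rewrite -has_predT.
move=> p p0 play follow.
(* The rank [k] drops with every move of either player. *)
suff main k t : k <= K -> p_win k (p t) -> exists t', at_goal (p t') White.
  by apply: (main K 0) => //; rewrite p0.
elim: k t => [|k IH] t lt; first by rewrite p_win0; exists t.
rewrite p_winS; case: ifP => [/liveP live_t|_]; last by exists t.
have legal_t := (play t).1 live_t.
case: ifP => [wt|_ /all_kidsP /(_ _ legal_t)]; last exact: IH (ltnW lt).
move=> Hhas; apply: (IH t.+1) (ltnW lt) _.
have -> : p t.+1 = win_strategy K P0 (mkseq p t.+1).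
  by apply: follow => //; move: wt; rewrite /white_to_move; case: turn.
rewrite mkseqS /win_strategy last_rcons.
set a := fun k => has (p_win k) (kids (p t)); set m := find a _.
(* The strategy sees only the history and does not know [k]. By choosing the least rank it finds
   some [m <= k], and monotonicity brings the successor back to rank [k]. *)
have le : m <= k.
  rewrite leqNgt; apply/negP => lt'.
  by have := before_find 0 lt'; rewrite nth_iota ?add0n // /a Hhas.
have am : a m.
  have H : has a (iota 0 K) by apply/hasP; exists k; rewrite ?mem_iota.
  have := nth_find 0 H; rewrite nth_iota ?add0n //.
  exact: leq_ltn_trans le lt.
rewrite [has _ _]am; apply: p_win_leq le _; exact: nth_find.
Qed.

(** By contraposition: against any [sigma], Black keeps the play among positions not won at depth
    [T]. By stability these are won at no depth, in particular not at depth 0, so White never gets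
    to the goal. *)
Lemma can_force_win_p_win P0 : white_can_force_win P0 ->
  p_win (#|{: spot}| * (supplies P0).+1) P0.
Proof.
set T := _ * _; move=> [sigma [legal_sigma wins]]; apply/negPn/negP => nwin.
(* The bound on supplies makes [T] large enough for [p_win_stable] at every position of the play. *)
pose lost P := supplies P <= supplies P0 /\ ~~ p_win T P.
have never P k : lost P -> ~~ p_win k P.
  case=> le; apply: contra => /p_win_stable; apply: p_win_leq.
  by rewrite leq_mul2l ltnS le orbT.
pose escape P := nth P (kids P) (find (predC (p_win T)) (kids P)).
pose reply h := let P := last P0 h in
  if liveb P then (if white_to_move P then sigma h else escape P) else P.
(* [sigma] reads the whole history, so the play is built as a growing list. *)
pose hist t := iter t (fun h => rcons h (reply h)) [:: P0].
pose p t := last P0 (hist t).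
have pS t : p t.+1 = reply (hist t) by rewrite /p /= last_rcons.
have histE t : hist t = mkseq p t.+1.
  by elim: t => // t IH; rewrite mkseqS -IH pS.
have white_reply t : liveb (p t) -> white_to_move (p t) -> p t.+1 = sigma (mkseq p t.+1).
  by move=> Hl Hw; rewrite pS /reply -/(p t) Hl Hw histE.
have black_reply t : liveb (p t) -> ~~ white_to_move (p t) -> p t.+1 = escape (p t).
  by move=> Hl /negbTE Hw; rewrite pS /reply -/(p t) Hl Hw.
(* A lost position is also not won at depth [T.+1]; unfolding one move leaves exactly depth [T] for
   the successors. The same device handles White's moves below. *)
have has_escape P : lost P -> liveb P -> ~~ white_to_move P -> has (predC (p_win T)) (kids P).
  move=> HP Hl /negbTE Hw; have := never P T.+1 HP; rewrite p_winS Hl Hw.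
  by rewrite has_predC.
have white_legal t : liveb (p t) -> white_to_move (p t) -> legal_move (p t) (p t.+1).
  move=> Hl Hw; rewrite white_reply // mkseqS; apply: legal_sigma; last exact/liveP.
  by move: Hw; rewrite /white_to_move; case: turn.
have lost_p t : lost (p t) /\ (liveb (p t) -> legal_move (p t) (p t.+1)).
  have legal t' : lost (p t') -> liveb (p t') -> legal_move (p t') (p t'.+1).
    move=> HP Hl; case: (boolP (white_to_move (p t'))) => Hw; first exact: white_legal.
    rewrite black_reply //; apply: nth_kids_legal; rewrite -has_find; exact: has_escape.
  suff H : lost (p t) by split=> //; apply: legal.
  elim: t => [|t IH]; first by [].
  case Hl: (liveb (p t)); last by rewrite pS /reply -/(p t) Hl.
  have Hm := legal t IH Hl; split; first by apply: leq_trans (legal_supplies_leq Hm) IH.1.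
  case: (boolP (white_to_move (p t))) => Hw.
    have := never _ T.+1 IH; rewrite p_winS Hl Hw; apply: contra => H.
    by apply/has_kidsP; exists (p t.+1).
  by rewrite black_reply //; apply: (nth_find (p t) (has_escape _ IH Hl Hw)).
have play : is_play p.
  move=> t; split=> [/liveP Hl|Hl]; first by case: (lost_p t) => _; apply.
  by rewrite pS /reply -/(p t); case: (liveP (p t)).
have follow : white_follows sigma p.
  by move=> t Ht /liveP Hl; apply: white_reply => //; rewrite /white_to_move Ht.
have [t] := wins p erefl play follow; rewrite -[at_goal _ _]/(won (p t)) -p_win0.
by apply/negP/never; case: (lost_p t).
Qed.

Lemma can_force_win_iff P0 : white_can_force_win P0 <->
  p_win (n * n * (n * n) * 2 * (supplies P0).+1) P0.
Proof.
have -> : n * n * (n * n) * 2 = #|{: spot}| by rewrite !card_prod card_bool !card_ord.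
split; [exact: can_force_win_p_win | exact: p_win_can_force_win].
Qed.

Lemma depthE p P : represents p P -> n_depth p = n * n * (n * n) * 2 * (supplies P).+1.
Proof. by case=> V _ ->. Qed.

End Game.

Lemma n_quoridorP w : n_quoridor w <-> QUORIDOR w.
Proof.
rewrite /n_quoridor eqbitsE; split.
  have Uw : uniq (n_parse w).2.1 by apply/filter_uniq/uniq_n_walls.
  have Sw : {subset (n_parse w).2.1 <= n_walls (n_parse w).1.1} by apply/mem_subseq/filter_subseq.
  move: (n_parse w) Uw Sw => p Up Sp /and3P[/eqP Ew Hv Hw].
  (* The range checks in [n_valid] turn the parsed coordinates of the pawns into ordinals. *)
  have [P HP] : exists P : position p.1.1, represents p P.
    by case/and5P: Hv => /andP[H1 H2] /andP[H3 H4] _ _ _; apply: represents_exists.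
  exists p.1.1, P; split.
  - exact/(validE HP Up).
  - by rewrite Ew; apply: encodeE.
  - by apply/can_force_win_iff; rewrite -(winE _ HP) -(depthE HP).
move=> [n [P [Hv -> Hw]]]; have [V HV Ep] := parse_encode P.
have HP : represents (n_parse (encode P)) P by exists V.
have Up : uniq (n_parse (encode P)).2.1 by apply/filter_uniq/uniq_n_walls.
rewrite (encodeE HP) eqxx (introT idP ((validE HP Up).2 Hv)) (winE _ HP) /=.
by rewrite (depthE HP); apply/can_force_win_iff.
Qed.

Theorem theorem1 : PSPACE QUORIDOR.
Proof. exact: PSPACE_PS PS_n_quoridor n_quoridorP. Qed.
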